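(* Let $d\geq 1$, let $X=\ell_p(\mathbb N)$ with $p\in[1,+\infty)$ or $X=c_0(\mathbb N)$, let $I\subset(0,+\infty)$ be $\sigma$-compact and let $(w(\lambda))_{\lambda\in I}$ be a continuous family of admissible weights on $X$. Assume that, for every compact set $I_0\subset I$, there exist $D_1,D_2,\gamma>0$ and an integer $N\geq 0$ such that, for all $n\geq N$, (1) the function $a\in I_0\mapsto \sum_{i=1}^n\log\big(w_i(a)\big)$ is $D_1\log(n)$-Lipschitz; (2) $\inf_{a\in I_0} w_1(a)\cdots w_n(a)\geq D_2 n^\gamma$. Then the family $\big(B_{w(\lambda_1)}\times\cdots\times B_{w(\lambda_d)}\big)_{\lambda=(\lambda_1,\dots,\lambda_d)\in I^d}$ of operators on $X^d$ admits a common hypercyclic algebra for the coordinatewise product.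
   Context: Sequences are complex and indexed by $n\ge 0$. A weight is a sequence $w=(w_n)_{n\geq 1}$ of positive real numbers; the weighted backward shift is $B_w(x_0,x_1,x_2,\dots)=(w_1x_1,w_2x_2,\dots)$, and $w$ is called admissible if $B_w$ is a well-defined continuous operator on $X$. For $\lambda\in I$ we write $w(\lambda)=(w_n(\lambda))_{n\ge1}$. The family is a continuous family: each $\lambda\mapsto w_n(\lambda)$ is continuous and the map $(\lambda,v)\mapsto T_\lambda(v)$ is continuous from $I^d\times X^d$ into $X^d$, where $T_\lambda=B_{w(\lambda_1)}\times\cdots\times B_{w(\lambda_d)}$, i.e. $T_\lambda(x^{(1)},\dots,x^{(d)})=(B_{w(\lambda_1)}x^{(1)},\dots,B_{w(\lambda_d)}x^{(d)})$. The coordinatewise product of sequences is $(a_n)_n\cdot(b_n)_n=(a_nb_n)_n$; $X^d$ is an algebra with this product applied in each of its $d$ components. A vector $x$ is hypercyclic for an operator $T$ if $\{T^n(x):n\geq 1\}$ is dense in the space; $HC(T)$ is the set of hypercyclic vectors of $T$. A family $(T_\lambda)_{\lambda\in\Lambda}$ of operators on a topological algebra $Y$ admits a common hypercyclic algebra if there is a non-trivial (i.e. nonzero) subalgebra $A$ of $Y$ with $A\setminus\{0\}\subset\bigcap_{\lambda\in\Lambda}HC(T_\lambda)$. *)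

(* Defs.v *)
From HB Require Import structures.
From mathcomp Require Import all_boot all_order all_algebra.
From mathcomp Require Import complex.
From mathcomp Require Import all_classical all_reals all_analysis.

Set Implicit Arguments.
Unset Strict Implicit.
Unset Printing Implicit Defensive.

Import Order.TTheory GRing.Theory Num.Theory.
Import numFieldNormedType.Exports.
Import ComplexField.Normc.

Local Open Scope classical_set_scope.
Local Open Scope complex_scope.
Local Open Scope ring_scope.

Inductive seqspace (R : realType) : Type := ell (p : R) of 1 <= p | c0.
Arguments c0 {R}.

Section seqspace_norm.
Variable R : realType.
Implicit Types (X : seqspace R) (x y : nat -> R[i]).

Definition ell_norm (p : R) x : \bar R :=
  'N[counting]_p%:E[EFin \o (@normc R \o x)]%E.

Definition in_seqspace X : {pred nat -> R[i]} := fun x =>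
  match X with
  | ell p _ => (ell_norm p x < +oo)%E
  | c0 => `[< (fun n => normc (x n)) @ \oo --> (0 : R) >]
  end.

Definition seqnorm X x : R :=
  match X with
  | ell p _ => fine (ell_norm p x)
  | c0 => sup (range (fun n => normc (x n)))
  end.

Lemma normc_ge0 (z : R[i]) : 0 <= normc z.
Proof. by case: z => a b; rewrite /normc sqrtr_ge0. Qed.
Hint Resolve normc_ge0 : core.

Lemma ell_norm_ge0 p x : (0 <= ell_norm p x)%E.
Proof. exact: Lnorm_ge0. Qed.

Lemma ell_normE p x : 1 <= p ->
  ell_norm p x = ((\sum_(n <oo) (normc (x n) `^ p)%:E) `^ p^-1)%E.
Proof.
move=> p1; rewrite /ell_norm Lnorm_counting ?(lt_le_trans ltr01)//.
congr (_ `^ _)%E; apply: eq_eseriesr => n _.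
by rewrite /= ger0_norm.
Qed.

Lemma powR_inv_id (a p : R) : 1 <= p -> 0 <= a -> (a `^ p) `^ p^-1 = a.
Proof.
move=> p1 a0; rewrite -powRrM divff ?powRr1//.
by rewrite gt_eqF// (lt_le_trans ltr01).
Qed.

Lemma ell_coord_le p x k : 1 <= p -> ((normc (x k))%:E <= ell_norm p x)%E.
Proof.
move=> p1; rewrite ell_normE//.
rewrite -(powR_inv_id p1 (normc_ge0 (x k))) -poweR_EFin.
have le : ((normc (x k) `^ p)%:E <= \sum_(n <oo) (normc (x n) `^ p)%:E)%E.
  apply: le_trans (nneseries_lim_ge k.+1 _); last first.
    by move=> n _ _; rewrite lee_fin powR_ge0.
  rewrite big_nat_recr//= leeDr// sume_ge0// => n _.
  by rewrite lee_fin powR_ge0.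
apply: gt0_ler_poweR => //.
- by rewrite invr_ge0 (le_trans ler01).
- by rewrite in_itv/= lee_fin powR_ge0 leey.
- by rewrite in_itv/= leey andbT (le_trans _ le)// lee_fin powR_ge0.
Qed.

Lemma ell_norm_le p x y (C : R) : 1 <= p -> 0 <= C ->
  (forall n, normc (x n) <= C * normc (y n)) ->
  (ell_norm p x <= C%:E * ell_norm p y)%E.
Proof.
move=> p1 C0 xy; rewrite !ell_normE//.
have p0 : 0 <= p by exact: le_trans p1.
have pV0 : 0 <= p^-1 by rewrite invr_ge0.
have s0 z : (0 <= \sum_(n <oo) (normc (z n) `^ p)%:E)%E.
  by apply: nneseries_ge0 => n _ _; rewrite lee_fin powR_ge0.
rewrite -[X in (X%:E * _)%E](powR_inv_id p1 C0) -poweR_EFin.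
rewrite -poweRM ?lee_fin ?powR_ge0//.
have le : (\sum_(n <oo) (normc (x n) `^ p)%:E <=
    (C `^ p)%:E * \sum_(n <oo) (normc (y n) `^ p)%:E)%E.
  rewrite -nneseriesZl; last by move=> n _; rewrite lee_fin powR_ge0.
  apply: lee_nneseries => n _; rewrite ?lee_fin ?powR_ge0// -powRM//.
  by rewrite ge0_ler_powR// nnegrE// mulr_ge0.
apply: gt0_ler_poweR => //; rewrite in_itv/= leey ?andbT//.
by rewrite mule_ge0// lee_fin powR_ge0.
Qed.

Lemma ell_normD p x y : 1 <= p ->
  (ell_norm p (x + y)%R <= ell_norm p x + ell_norm p y)%E.
Proof.
move=> p1; pose f n := normc (x n); pose g n := normc (y n).
have := @eminkowski _ nat R counting f g p%:E.
rewrite lee_fin p1 => /(_ _ _ isT) h; apply: le_trans (h _ _) => //.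
pose z n : R[i] := (f n + g n)%:C.
have zE n : normc (z n) = f n + g n.
  rewrite /normc /= expr0n/= addr0 sqrtr_sqr ger0_norm//.
  by rewrite addr_ge0 ?normc_ge0.
have -> : 'N[counting]_p%:E[EFin \o (f \+ g)%R]%E = ell_norm p z.
  by apply: eq_Lnorm => n; congr EFin; rewrite -[RHS]/(normc (z n)) zE.
rewrite -[leRHS]mul1e; apply: ell_norm_le => // n.
by rewrite mul1r zE le_normcD.
Qed.

Lemma ell_norm_fin p x : (ell_norm p x < +oo)%E ->
  ell_norm p x = (fine (ell_norm p x))%:E.
Proof. by move=> xoo; rewrite fineK ?ge0_fin_numE ?ell_norm_ge0. Qed.

Lemma c0_ubound x : (fun n => normc (x n)) @ \oo --> (0 : R) ->
  has_ubound (range (fun n => normc (x n))).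
Proof.
move=> x0; apply: bounded_fun_has_ubound; apply: cvg_seq_bounded.
exact: cvgP x0.
Qed.

Lemma seqnorm_coord_le X x n : x \in in_seqspace X -> normc (x n) <= seqnorm X x.
Proof.
case: X => [p p1|]; rewrite unfold_in /=.
  by move=> xoo; rewrite -lee_fin -ell_norm_fin// ell_coord_le.
by move=> /asboolP /c0_ubound ub; apply: ub_le_sup => //; exists n.
Qed.

Lemma seqnorm_dom X x y (C : R) : 0 <= C -> y \in in_seqspace X ->
  (forall n, normc (x n) <= C * normc (y n)) ->
  x \in in_seqspace X /\ seqnorm X x <= C * seqnorm X y.
Proof.
move=> C0 + xy; case: X => [p p1|]; rewrite !unfold_in /=.
  move=> yoo; have h := ell_norm_le p1 C0 xy.
  have xoo : (ell_norm p x < +oo)%E.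
    by apply: le_lt_trans h _; rewrite (ell_norm_fin yoo) -EFinM ltry.
  split=> //; rewrite -lee_fin EFinM -ell_norm_fin//.
  by rewrite -ell_norm_fin.
move=> /asboolP y0; split.
  apply/asboolP; apply: (@squeeze_cvgr _ _ _ _ (cst 0) (fun n => C * normc (y n))).
  - by apply: nearW => n; rewrite xy andbT.
  - exact: cvg_cst.
  - by rewrite -(mulr0 C); apply: cvgMr.
apply: ge_sup; first by exists (normc (x 0%N)); exists 0%N.
move=> _ [n _ <-]; apply: le_trans (xy n) _.
by apply: ler_wpM2l => //; apply: ub_le_sup; [exact: c0_ubound|exists n].
Qed.

Lemma seqnormD X x y : x \in in_seqspace X -> y \in in_seqspace X ->
  x + y \in in_seqspace X /\ seqnorm X (x + y) <= seqnorm X x + seqnorm X y.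
Proof.
case: X => [p p1|]; rewrite !unfold_in /=.
  move=> xoo yoo; have h := ell_normD x y p1.
  have xyoo : (ell_norm p (x + y)%R < +oo)%E.
    by apply: le_lt_trans h _; rewrite lte_add_pinfty.
  split=> //; rewrite -lee_fin EFinD -ell_norm_fin//.
  by rewrite -!ell_norm_fin.
move=> /asboolP x0 /asboolP y0; split.
  apply/asboolP; apply: (@squeeze_cvgr _ _ _ _ (cst 0)
    (fun n => normc (x n) + normc (y n))).
  - by apply: nearW => n; rewrite normc_ge0 le_normcD.
  - exact: cvg_cst.
  - by rewrite -(addr0 (0 : R)); apply: cvgD.
apply: ge_sup; first by exists (normc ((x + y) 0%N)); exists 0%N.
move=> _ [n _ <-]; apply: le_trans (le_normcD _ _) _.
by apply: lerD; apply: ub_le_sup; [exact: c0_ubound|exists n|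
  exact: c0_ubound|exists n].
Qed.

Lemma seqspace0 X : (0 : nat -> R[i]) \in in_seqspace X.
Proof.
have z n : normc ((0 : nat -> R[i]) n) = 0 by exact: normc0.
case: X => [p p1|]; rewrite unfold_in /=.
  have := @ell_norm_le p 0 0 0 p1 (lexx _).
  rewrite mul0e => h; apply: le_lt_trans (h _) (ltry _) => n.
  by rewrite mul0r le_eqVlt; apply/orP; left; apply/eqP; exact: z.
by apply/asboolP; rewrite (_ : (fun=> _) = cst 0);
  [exact: cvg_cst|apply/funext => n; exact: z].
Qed.

Lemma seqspaceZ X (c : R[i]) x : x \in in_seqspace X ->
  c *: x \in in_seqspace X.
Proof.
have b n : normc ((c *: x) n) <= normc c * normc (x n).
  by rewrite -normcM.
by move=> xX; exact: (proj1 (seqnorm_dom (normc_ge0 c) xX b)).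
Qed.

Lemma seqspaceM X x y : x \in in_seqspace X -> y \in in_seqspace X ->
  x * y \in in_seqspace X.
Proof.
move=> xX yX.
have b n : normc ((x * y) n) <= seqnorm X x * normc (y n).
  by rewrite normcM ler_wpM2r// seqnorm_coord_le.
apply: (proj1 (seqnorm_dom _ yX b)).
exact: le_trans (normc_ge0 _) (seqnorm_coord_le 0 xX).
Qed.

Lemma in_seqspace_submod_closed X : submod_closed (in_seqspace X).
Proof.
split=> [|c x y xX yX]; first exact: seqspace0.
by apply: (proj1 (seqnormD _ yX)); exact: seqspaceZ.
Qed.

HB.instance Definition _ X := GRing.isSubmodClosed.Build R[i] (nat -> R[i])
  (in_seqspace X) (in_seqspace_submod_closed X).

End seqspace_norm.

Record seqs (R : realType) (X : seqspace R) :=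
  Seqs { seqval :> nat -> R[i] ; seqvalP : seqval \in in_seqspace X }.

Coercion seqs : seqspace >-> Sortclass.

Section seqs_normed.
Variables (R : realType) (X : seqspace R).
Implicit Types x y : X.

HB.instance Definition _ := [isSub of seqs X for @seqval R X].
HB.instance Definition _ := [Choice of seqs X by <:].
HB.instance Definition _ := [SubChoice_isSubLmodule of seqs X by <:].

(* A norm over the numFieldType R[i] takes its values in R[i]. *)
Let norm x : R[i] := (seqnorm X x)%:C.

Let norm_triangle x y : norm (x + y) <= norm x + norm y.
Proof. by rewrite /norm -rmorphD lecR (seqnormD (seqvalP x) (seqvalP y)).2. Qed.

Let normZ_le (c : R[i]) x : seqnorm X (c *: x) <= normc c * seqnorm X x.
Proof.
apply: (seqnorm_dom (normc_ge0 c) (seqvalP x) _).2 => n.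
by rewrite -normcM.
Qed.

Let normZ (c : R[i]) x : norm (c *: x) = `|c| * norm x.
Proof.
have -> : `|c| = (normc c)%:C by case: c.
rewrite /norm -rmorphM; congr (_%:C); apply/eqP; rewrite eq_le normZ_le/=.
have [->|c0] := eqVneq c 0.
  rewrite normc0 mul0r; apply: le_trans (normc_ge0 ((0 *: x) 0%N)) _.
  exact: seqnorm_coord_le (seqvalP (0 *: x)).
have nc0 : 0 < normc c.
  by rewrite lt0r normc_ge0 andbT; apply: contra_neq c0 => /eq0_normc.
rewrite -ler_pdivlMl// -normcV -{1}[x](scalerK c0).
exact: normZ_le.
Qed.

Let norm_eq0 x : norm x = 0 -> x = 0.
Proof.
move=> [x0]; apply: val_inj; apply/funext => n /=.
apply: eq0_normc; apply/eqP; rewrite eq_le normc_ge0 andbT -x0.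
exact: seqnorm_coord_le (seqvalP x).
Qed.

HB.instance Definition _ := Lmodule_isNormed.Build R[i] (seqs X)
  norm_triangle normZ norm_eq0.

Definition seqmul x y : X := Seqs (seqspaceM (seqvalP x) (seqvalP y)).

Definition wshift_seq (w : nat -> R) (x : nat -> R[i]) : nat -> R[i] :=
  fun n => (w n.+1)%:C * x n.+1.

(* B_w as a total map X -> X: it takes the dummy value 0 at those x for which
   wshift_seq w x is not in X; there is no such x when w is admissible. *)
Definition wshift (w : nat -> R) x : X := insubd (0 : X) (wshift_seq w x).

(* The entry w 0 is unused: weights are indexed by n >= 1. *)
Definition weight (w : nat -> R) := forall n, (1 <= n)%N -> 0 < w n.

Definition admissible (w : nat -> R) :=
  (forall x, wshift_seq w x \in in_seqspace X) /\ continuous (wshift w).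

End seqs_normed.

(* X^d with its product topology and componentwise operations. *)
Definition power (d : nat) (T : Type) := 'I_d -> T.

HB.instance Definition _ (d : nat) (K : numFieldType) (V : normedModType K) :=
  GRing.Lmodule.copy (power d V) ('I_d -> V).
HB.instance Definition _ (d : nat) (K : numFieldType) (V : normedModType K) :=
  Topological.copy (power d V) {ptws 'I_d -> V}.

Section shift_family.
Variables (R : realType) (X : seqspace R) (d : nat).

Definition power_mul (x y : power d X) : power d X :=
  fun i => seqmul (x i) (y i).

Definition wshift_prod (w : R -> nat -> R) (lambda : power d R)
    (x : power d X) : power d X :=
  fun i => wshift (w (lambda i)) (x i).

Definition cube (I : set R) : set (power d R) :=
  [set lambda | forall i, I (lambda i)].

Definition continuous_family (I : set R) (w : R -> nat -> R) :=
  (forall n, (1 <= n)%N -> {within I, continuous (fun a => w a n)}) /\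
  {within cube I `*` setT, continuous
    (fun p : power d R * power d X => wshift_prod w p.1 p.2)}.

End shift_family.
Arguments cube {R} d I.

Definition sigma_compact (T : topologicalType) (A : set T) :=
  exists K : nat -> set T, (forall n, compact (K n)) /\ A = \bigcup_n K n.

Definition HC (Y : topologicalType) (T : Y -> Y) : set Y :=
  [set x | dense [set iter n T x | n in [set n | (1 <= n)%N]]].

Section hypercyclic_algebra.
Variables (K : numFieldType) (Y : preTopologicalLmodType K) (mul : Y -> Y -> Y).

Definition subalgebra (A : set Y) :=
  [/\ A 0,
      forall x y, A x -> A y -> A (x + y),
      forall (c : K) x, A x -> A (c *: x) &
      forall x y, A x -> A y -> A (mul x y)].

Definition common_hypercyclic_algebra (L : Type) (Lambda : set L)
    (T : L -> Y -> Y) :=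
  exists A : set Y,
    [/\ subalgebra A,
        A `\ 0 !=set0 &
        A `\ 0 `<=` \bigcap_(lambda in Lambda) HC (T lambda)].

End hypercyclic_algebra.

(* Main.v *)
(* Write P_n(a) = w_1(a) ... w_n(a).  A single vector u is built whose polynomials
   without constant term form the algebra.  For a polynomial of lowest degree m0
   it is enough that, for each parameter lam, some iterate T_lam^n brings u^m0 close
   to a prescribed target while making |u|^(m0+1) small; all errors are measured in
   the l^1 norm, which dominates the norm of X.  Once the parameters are localised
   to small cubes there are countably many such tasks, and they are met one after
   the other by prescribing more and more coordinates of u.

   In one task the cube, of side rho with D1 rho <= gamma / 2, is covered by
   q = m^d cells of side rho / m with points lam_1, ..., lam_q, and on the block
   starting at N i, for i <= q, u is the m0-th root of target / P(lam_i).  For lam in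
   the i-th cell, T_lam^(N i) reproduces the target up to a factor
   exp (O (log (N q) / m)), and a later block contributes at most a multiple of
   (N q)^(gamma / 2) / N^gamma.  Taking N a large power of m makes both errors
   small, even after multiplication by the number q of blocks. *)

Require Import Defs.
From HB Require Import structures.
From mathcomp Require Import all_boot all_order all_algebra.
From mathcomp Require Import complex.
From mathcomp Require Import all_classical all_reals all_analysis.
From mathcomp Require Import ring lra zify.

Set Implicit Arguments.
Unset Strict Implicit.
Unset Printing Implicit Defensive.

Import Order.TTheory GRing.Theory Num.Theory.
Import numFieldNormedType.Exports.
Import ComplexField.Normc.

Local Open Scope classical_set_scope.
Local Open Scope complex_scope.
Local Open Scope ring_scope.

(** * Cylinders and a fusion argument *)

(** The basic sets of a Baire-type construction. The tail bound concerns finite sums only, so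
    coordinatewise limits stay inside. *)
Definition cylinder (R : realType) (J : Type) (f : J -> nat -> R[i]) (n : nat)
    (e : R) : set (J -> nat -> R[i]) :=
  [set u | (forall k j, (j < n)%N -> u k j = f k j) /\
           forall k M, \sum_(n <= j < M) normc (u k j) <= e].

Lemma cylinder_trunc (R : realType) (J : Type) (f : J -> nat -> R[i]) n (e : R) :
  0 <= e -> cylinder f n e (fun k j => if (j < n)%N then f k j else 0).
Proof.
move=> e0; split=> [k j ->//|k M].
rewrite big_nat_cond big1 // => j; rewrite andbT => /andP[nj _].
by rewrite ltnNge nj; exact: normc0.
Qed.

(** A Baire-type argument: nested cylinders of strictly increasing length determine every coordinate
    of one limit vector, which lies in all of them and so meets every requirement. *)
Lemma cylinder_fusion (R : realType) (J : Type)
    (Req : nat -> set (J -> nat -> R[i])) :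
  (forall i f n (e : R), 0 < e -> exists f' n' (e' : R),
    [/\ 0 < e', (n < n')%N, cylinder f' n' e' `<=` cylinder f n e &
        cylinder f' n' e' `<=` Req i]) ->
  forall f n (e : R), 0 < e ->
    exists2 u, cylinder f n e u & forall i, Req i u.
Proof.
move=> H f n e e0.
pose state := ((J -> nat -> R[i]) * nat * R)%type.
pose cyl (s : state) := cylinder s.1.1 s.1.2 s.2.
have H' (x : nat * state) : exists s' : state, 0 < x.2.2 ->
    [/\ 0 < s'.2, (x.2.1.2 < s'.1.2)%N, cyl s' `<=` cyl x.2 & cyl s' `<=` Req x.1].
  (* For [e1 <= 0] the state is returned unchanged, a dummy that makes the choice function total. *)
  case: x => i [[f1 n1] e1]; have [e1p|] := ltP 0 e1; last by exists (f1, n1, e1).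
  by have [f' [n' [e' ?]]] := H i f1 n1 e1 e1p; exists (f', n', e').
have [F FP] := choice H'.
pose S := fix S i : state := if i is i'.+1 then F (i', S i') else (f, n, e).
have Spos i : 0 < (S i).2 by elim: i => //= i /(FP (i, _))[].
have Sstep i := FP (i, S i) (Spos i).
have Sn i : (i <= (S i).1.2)%N.
  by elim: i => // i IH; have [_ h _ _] := Sstep i; exact: leq_ltn_trans IH h.
have Ssub i i' : (i <= i')%N -> cyl (S i') `<=` cyl (S i).
  move=> /subnKC <-; elim: (_ - _)%N => [|m IH]; first by rewrite addn0.
  by rewrite addnS; have [_ _ h _] := Sstep (i + m)%N; exact: subset_trans h IH.
pose tr (s : state) k j := if (j < s.1.2)%N then s.1.1 k j else 0.
have trP i : cyl (S i) (tr (S i)) by exact/cylinder_trunc/ltW.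
(* The truncated centre of a later cylinder is a point of every earlier one, so centres agree on the
   coordinates already prescribed. *)
have Sf i i' k j : (i <= i')%N -> (j < (S i).1.2)%N -> tr (S i') k j = (S i).1.1 k j.
  by move=> ii' ji; have [h _] := Ssub _ _ ii' _ (trP i'); exact: h.
(* Stage [i] prescribes at least [i] coordinates, so coordinate [j] is settled at stage [j.+1]. *)
pose u k j := (S j.+1).1.1 k j.
have uE i k j : (j < i)%N -> u k j = tr (S i) k j.
  by move=> ji; rewrite (Sf j.+1)//; exact: Sn.
have uS i : cyl (S i) u.
  split=> [k j ji|k M].
    by rewrite (uE (maxn i j.+1)) ?leq_maxr// (Sf i)// leq_maxl.
  have [_ h] := Ssub _ _ (leq_maxl i M) _ (trP (maxn i M)).
  apply: le_trans (h k M); rewrite le_eqVlt; apply/orP; left; apply/eqP.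
  apply: eq_big_nat => j /andP[_ jM]; rewrite (uE (maxn i M))//.
  exact: leq_trans jM (leq_maxr _ _).
exists u; first exact: (uS 0%N).
by move=> i; have [_ _ _ h] := Sstep i; exact: h _ (uS i.+1).
Qed.

(** * Choice of the mesh and of the block length *)

(* Take m = t ^ 2 and N = t ^ s with s a large constant, and let t tend to infinity. *)
Lemma mesh_parameters (R : realType) (d m0 b0 : nat) (gamma kappa D2 Y tau eps : R) :
  (0 < m0)%N -> 0 < gamma -> 0 <= kappa -> 0 < D2 -> 0 <= Y -> 0 < tau -> 0 < eps ->
  exists (m N : nat) (theta : R),
    [/\ (0 < m)%N /\ (b0 < N)%N,
        kappa / m%:R * ln (N * (m ^ d).+1)%:R <= tau,
        0 < theta /\ theta * (m ^ d).+1%:R <= eps,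
        Y <= theta ^+ m0 * (D2 * N%:R `^ gamma) &
        (N * (m ^ d).+1)%:R `^ (gamma / 2) * (m ^ d).+1%:R <= eps * N%:R `^ gamma].
Proof.
(* Exponent with [(m ^ d).+1 <= t ^ e]: here [m ^ d = t ^ (d + d)], and one more factor [t >= 2]
   absorbs the successor. *)
move=> m0_gt0 g0 k0 D20 Y0 tau0 eps0.
pose e := (d + d).+1.
(* Both inequalities compare exponents of [t]: the first serves the bound on [Y], the second the
   last conclusion. Each leaves a spare factor [t] to absorb constants. *)
have [s [s0 hs1 hs2]] : exists s : nat, [/\ (0 < s)%N,
    1 + (e.+1 * m0)%:R <= s%:R * gamma &
    e%:R + 1 + (s + e)%:R * (gamma / 2) <= s%:R * gamma].
  pose x := (1 + (e.+1 * m0)%:R) / gamma + (e%:R + 1) / gamma * 2 + e%:R.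
  have a0 : 0 <= (1 + (e.+1 * m0)%:R) / gamma by rewrite divr_ge0 ?addr_ge0// ltW.
  have b00 : 0 <= (e%:R + 1) / gamma by rewrite divr_ge0 ?addr_ge0// ltW.
  have x0 : 0 <= x by rewrite /x !addr_ge0// mulr_ge0.
  have := archi_boundP x0; set s := Num.bound x => xs.
  have e1 : (1 + (e.+1 * m0)%:R) = (1 + (e.+1 * m0)%:R) / gamma * gamma :> R.
    by rewrite divfK// gt_eqF.
  have e2 : (e%:R + 1) = (e%:R + 1) / gamma * gamma :> R by rewrite divfK// gt_eqF.
  have ee : 0 <= e%:R :> R by [].
  exists s; split.
  - by rewrite -(ltr_nat R); apply: le_lt_trans x0 xs.
  - by rewrite e1 ler_wpM2r ?ltW//; apply: le_lt_trans xs; rewrite /x; nra.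
  - by rewrite e2 natrD; rewrite /x in xs; nra.
(* [t] is taken above each summand, one for every lower bound required below. *)
pose y := 2 + b0%:R + kappa * (s + e)%:R / tau + eps^-1 + Y / D2.
have p1 : 0 <= kappa * (s + e)%:R / tau by rewrite divr_ge0 ?mulr_ge0// ltW.
have p2 : 0 <= eps^-1 by rewrite invr_ge0 ltW.
have p3 : 0 <= Y / D2 by rewrite divr_ge0// ltW.
have p4 : 0 <= b0%:R :> R by [].
have y0 : 0 <= y by rewrite /y !addr_ge0.
have := archi_boundP y0; set t := Num.bound y => yt.
have t2 : 2 <= t%:R :> R by rewrite /y in yt; lra.
have t2n : (1 < t)%N by rewrite -(ltr_nat R); lra.
have t0 : 0 < t%:R :> R by lra.
have t1 : 1 <= t%:R :> R by lra.
have tn0 : (0 < t)%N by apply: ltn_trans t2n.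
pose m := (t ^ 2)%N; pose N := (t ^ s)%N; pose q := (t ^ (d + d))%N.
have mdq : (m ^ d = q)%N by rewrite /m /q -expnM mul2n addnn.
have qle : (q.+1 <= t ^ e)%N.
  rewrite /e expnS -/q; apply: leq_trans (_ : 2 * q <= _)%N; last by rewrite leq_mul2r t2n orbT.
  by rewrite mul2n -addnn -addn1 leq_add2l expn_gt0 tn0.
have n'le : (N * q.+1 <= t ^ (s + e))%N by rewrite expnD leq_mul2l qle orbT.
have n'leR : (N * q.+1)%:R <= t%:R ^+ (s + e) :> R by rewrite -natrX ler_nat.
have n'gt0 : (0 < N * q.+1)%N by rewrite muln_gt0 expn_gt0 tn0.
have NE : N%:R = t%:R `^ s%:R :> R by rewrite powR_mulrn ?ltW// -natrX.
have epst : eps * t%:R >= 1.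
  by rewrite mulrC -ler_pdivrMr// div1r; rewrite /y in yt; lra.
pose theta : R := t%:R ^- e.+1.
have theta0 : 0 < theta by rewrite invr_gt0 exprn_gt0.
exists m, N, theta; rewrite mdq; split.
- split; first by rewrite expn_gt0 tn0.
  apply: (@leq_trans t); last by rewrite -{1}(expn1 t) leq_pexp2l.
  by rewrite -(ltr_nat R); rewrite /y in yt; lra.
(* With [m = t ^ 2], even the crude bound [ln t <= t] leaves only [kappa * (s + e) / t]. *)
- have lnt : ln (t%:R : R) <= t%:R.
    have := ln_sublinear t0; lra.
  have h1 : ln ((N * q.+1)%:R : R) <= (s + e)%:R * t%:R.
    apply: (@le_trans _ _ (ln (t%:R ^+ (s + e)))).
      by rewrite ler_ln// posrE ?exprn_gt0// ltr0n.
    by rewrite lnXn// -[leLHS]mulr_natl ler_wpM2l.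
  apply: (@le_trans _ _ (kappa / m%:R * ((s + e)%:R * t%:R))).
    by rewrite ler_wpM2l// divr_ge0.
  rewrite /m natrX expr2 invfM.
  rewrite (_ : _ * _ = kappa * (s + e)%:R / t%:R); last by field; rewrite gt_eqF.
  rewrite ler_pdivrMr// -ler_pdivrMl//.
  rewrite mulrC; rewrite /y in yt; lra.
- split => //; apply: (@le_trans _ _ (theta * t%:R ^+ e)).
    by rewrite ler_pM2l// -natrX ler_nat.
  rewrite /theta exprS invfM -mulrA mulVf ?mulr1 ?expf_neq0 ?gt_eqF//.
  by rewrite -div1r ler_pdivrMr.
- have -> : theta ^+ m0 * (D2 * N%:R `^ gamma) = D2 * (t%:R `^ (s%:R * gamma) / t%:R `^ (e.+1 * m0)%:R).
    rewrite NE -powRrM [in RHS]powR_mulrn ?ltW// /theta exprVn -exprM; ring.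
  rewrite -ler_pdivrMl// ler_pdivlMr ?powR_gt0//.
  apply: (@le_trans _ _ (t%:R * t%:R `^ (e.+1 * m0)%:R)).
    by rewrite ler_wpM2r ?powR_ge0// mulrC; rewrite /y in yt; lra.
  rewrite -{1}(powRr1 (ltW t0)) -powRD; last by rewrite (gt_eqF t0) implybT.
  exact: ler_powR.
- apply: (@le_trans _ _ (t%:R `^ ((s + e)%:R * (gamma / 2)) * t%:R `^ e%:R)).
    apply: ler_pM; rewrite ?powR_ge0//.
      rewrite [leRHS]powRrM ge0_ler_powR// ?nnegrE ?powR_ge0 ?divr_ge0 ?(ltW g0)//.
      by rewrite powR_mulrn ?(ltW t0).
    by rewrite powR_mulrn ?(ltW t0)// -natrX ler_nat.
  rewrite -powRD; last by rewrite (gt_eqF t0) implybT.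
  apply: (@le_trans _ _ (eps * t%:R * t%:R `^ ((s + e)%:R * (gamma / 2) + e%:R))).
    by rewrite ler_peMl// powR_ge0.
  rewrite -mulrA ler_pM2l// -{1}(powRr1 (ltW t0)) -powRD; last by rewrite (gt_eqF t0) implybT.
  rewrite NE -powRrM; apply: ler_powR => //; lra.
Qed.

(** * Moduli and finite sums *)

Lemma normcX (R : realType) (z : R[i]) n : normc (z ^+ n) = normc z ^+ n.
Proof.
elim: n => [|n IH]; first exact: normc1.
by rewrite !exprS normcM IH.
Qed.

Lemma normc_real (R : realType) (x : R) : normc x%:C = `|x|.
Proof. by rewrite /normc /= expr0n addr0 sqrtr_sqr. Qed.

Lemma normcB_le (R : realType) (x y : R[i]) : normc (x - y) <= normc x + normc y.
Proof. by apply: le_trans (le_normcD _ _) _; rewrite normcN. Qed.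

Lemma normc_le_subD (R : realType) (x y : R[i]) : normc x <= normc (x - y) + normc y.
Proof. by rewrite -{1}(subrK y x); exact: le_normcD. Qed.

Lemma sum_le_support (R : realType) (F : nat -> R) N M :
  (forall j, 0 <= F j) -> (forall j, (N <= j)%N -> F j = 0) ->
  \sum_(0 <= j < M) F j <= \sum_(0 <= j < N) F j.
Proof.
move=> F0 FN; have [MN|/ltnW NM] := leqP M N.
  by rewrite (big_cat_nat (leq0n M) MN)/= lerDl sumr_ge0.
rewrite (big_cat_nat (leq0n N) NM)/= (_ : \sum_(N <= j < M) F j = 0) ?addr0//.
by rewrite big_nat_cond big1// => j; rewrite andbT => /andP[/FN].
Qed.

Lemma sum_shift_le (R : realType) (F : nat -> R) a n M :
  (forall j, 0 <= F j) -> (a <= n)%N ->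
  \sum_(0 <= j < M) F (j + n)%N <= \sum_(a <= l < M + n) F l.
Proof.
move=> F0 an; have -> : \sum_(0 <= j < M) F (j + n)%N = \sum_(n <= l < M + n) F l.
  by rewrite -{2}(add0n n) big_addn addnK.
by rewrite (big_cat_nat an (leq_addl M n))/= lerDr sumr_ge0.
Qed.

Lemma sum_modn (R : realType) (F : nat -> R) N Q :
  \sum_(0 <= l < N * Q) F (l %% N)%N = Q%:R * \sum_(0 <= j < N) F j.
Proof.
rewrite mulnC big_nat_mul mulr_natl -[Q in RHS]subn0 -sumr_const_nat.
apply: eq_bigr => i _.
rewrite -{1}(add0n (i * N)%N) big_addn mulSn addnK; apply: eq_big_nat => j /andP[_ jN].
by rewrite addnC modnMDl modn_small.
Qed.

(** * Products of weights *)

Definition wprod (R : realType) (w : nat -> R) (n : nat) : R :=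
  \prod_(1 <= i < n.+1) w i.

Lemma wprod_gt0 (R : realType) (w : nat -> R) n : weight w -> 0 < wprod w n.
Proof.
by move=> w0; rewrite /wprod big_nat_cond prodr_gt0// => i; rewrite andbT => /andP[/w0].
Qed.

Lemma wprodD (R : realType) (w : nat -> R) j n :
  wprod w (j + n)%N = wprod w j * \prod_(j.+1 <= i < (j + n).+1) w i.
Proof. by rewrite /wprod (big_cat_nat (ltn0Sn j) (_ : j.+1 <= (j + n).+1)%N)// ltnS leq_addr. Qed.

Lemma wprod_ratio_le (R : realType) (w : nat -> R) (C : R) j n : weight w ->
  (forall i, (1 <= i)%N -> w i <= C) ->
  (wprod w j)^-1 * wprod w (j + n)%N <= C ^+ n.
Proof.
move=> w0 wC; rewrite wprodD mulKf ?gt_eqF ?wprod_gt0//.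
rewrite -[n in leRHS](addKn j) -subSS -prodr_const_nat big_nat_cond [leRHS]big_nat_cond.
by apply: ler_prod => i; rewrite andbT => /andP[ji _]; rewrite ltW ?w0 ?wC//; lia.
Qed.

(** From [N.+1] on, this is the growth bound with [j ^ g >= 1]. A smaller index is compared with
    [N.+1]: the two products differ by at most [N.+1] factors, each at most [C]. *)
Lemma wprod_ge (R : realType) (w : nat -> R) (C D g : R) N j : weight w ->
  (forall i, (1 <= i)%N -> w i <= C) -> 1 <= C -> 0 < D -> 0 <= g ->
  (forall n, (N <= n)%N -> D * n%:R `^ g <= wprod w n) ->
  D / C ^+ N.+1 <= wprod w j.
Proof.
move=> w0 wC C1 D0 g0 H.
have C0 : 0 < C by lra.
have CN n : 1 <= C ^+ n by exact: exprn_ege1.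
have D1 n : (N.+1 <= n)%N -> D <= wprod w n.
  move=> Nn; apply: le_trans (H n (ltnW Nn)); rewrite ler_peMr ?(ltW D0)//.
  rewrite -[leLHS](powRr0 n%:R); apply: ler_powR => //.
  by rewrite ler1n (leq_trans _ Nn).
rewrite ler_pdivrMr ?exprn_gt0//.
have [Nj|/ltnW jN] := leqP N.+1 j.
  by apply: le_trans (D1 _ Nj) _; rewrite ler_peMr// ltW ?wprod_gt0.
apply: le_trans (D1 _ (leqnn _)) _.
have := wprod_ratio_le j (N.+1 - j) w0 wC; rewrite subnKC//.
rewrite ler_pdivrMl ?wprod_gt0// => /le_trans; apply.
rewrite ler_pM2l ?wprod_gt0//; apply: ler_weXn2l => //; exact: leq_subr.
Qed.

(** With [z = x / y], the inequality [1 + s <= exp s] at [s = ln z] and [s = - ln z] gives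
    [1 + ln z <= z] and [(1 - ln z) * z <= 1]; then [t <= 1 / 2] yields [z <= 1 + 2 * t]. *)
Lemma ratio_near1 (R : realType) (x y t : R) : 0 < x -> 0 < y -> t <= 1 / 2 ->
  `|ln x - ln y| <= t -> `|x / y - 1| <= 2 * t.
Proof.
move=> x0 y0 t2; rewrite -ln_div ?posrE//; set z := x / y.
have z0 : 0 < z by rewrite divr_gt0.
have e1 := expR_ge1Dx (ln z); have e2 := expR_ge1Dx (- ln z).
rewrite expRN lnK ?posrE// in e2; rewrite lnK ?posrE// in e1.
have e3 : (1 - ln z) * z <= 1 by rewrite -ler_pdivlMr// div1r.
rewrite !ler_norml => /andP[h1 h2]; apply/andP; split; first lra.
nra.
Qed.

Lemma ratio_le_expR (R : realType) (x y t : R) : 0 < x -> 0 < y ->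
  `|ln x - ln y| <= t -> x / y <= expR t.
Proof.
move=> x0 y0; rewrite -ln_div ?posrE// => /ler_normlP[_ h].
by rewrite -[leLHS]lnK ?posrE ?divr_gt0// ler_expR.
Qed.

(** * Block vectors: size and approximation *)

(* Solves [P_l b_l ^+ m0 = y_(l mod N)] on each of the blocks
   [N i, N (i + 1)), 1 <= i <= q, the i-th one with the weight [mu i]. *)
Definition block_vector (R : realType) (mu : nat -> nat -> R) (y : nat -> R[i])
    (m0 N q l : nat) : R[i] :=
  if (N <= l < N * q.+1)%N then
    m0.-root (y (l %% N)%N / (wprod (mu (l %/ N)%N) l)%:C) else 0.

Lemma block_vectorX (R : realType) (mu : nat -> nat -> R) y m0 N q l :
  (0 < m0)%N -> weight (mu (l %/ N)%N) -> (N <= l < N * q.+1)%N ->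
  normc (block_vector mu y m0 N q l) ^+ m0 =
  normc (y (l %% N)%N) / wprod (mu (l %/ N)%N) l.
Proof.
move=> m0_gt0 w0 lN; rewrite -normcX /block_vector lN rootCK// normcM normcV normc_real.
by rewrite ger0_norm// ltW// wprod_gt0.
Qed.

(** On each block at most [L] coordinates are nonzero, each of modulus at most [theta] because its
    [m0]-th power is at most [Y / B]. The factor [q.+1] also counts the initial block, where the
    vector vanishes. *)
Lemma block_vector_sum_le (R : realType) (mu : nat -> nat -> R) y m0 N q L
    (theta Y B : R) :
  (0 < m0)%N -> (L <= N)%N -> (forall i, weight (mu i)) -> 0 < theta -> 0 < B ->
  (forall j, normc (y j) <= Y) -> (forall j, (L <= j)%N -> y j = 0) ->
  Y <= theta ^+ m0 * B ->
  (forall l, (N <= l < N * q.+1)%N -> B <= wprod (mu (l %/ N)%N) l) ->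
  \sum_(0 <= l < N * q.+1) normc (block_vector mu y m0 N q l) <=
    q.+1%:R * (L%:R * theta).
Proof.
move=> m0_gt0 LN w0 t0 B0 yY yL YB PB.
have -> : L%:R * theta = \sum_(0 <= j < N) (if (j < L)%N then theta else 0).
  rewrite (big_cat_nat (leq0n L) LN)/=.
  rewrite [X in _ + X](_ : _ = 0) ?addr0; last first.
    by rewrite big_nat_cond big1// => j; rewrite andbT leqNgt => /andP[/negbTE ->].
  rewrite (eq_big_nat _ _ (F2 := fun=> theta)); last by move=> j /andP[_ ->].
  by rewrite sumr_const_nat subn0 mulr_natl.
rewrite -sum_modn; apply: ler_sum => l _.
rewrite /block_vector; case: ifP => [lN|_]; last first.
  by rewrite normc0; case: ifP => // _; exact: ltW.
case: ifPn => [_|]; last first.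
  by rewrite -leqNgt => /yL ->; rewrite mul0r rootC0 normc0.
rewrite -[leLHS]/(normc _) -(ler_pXn2r m0_gt0) ?nnegrE ?normc_ge0 ?(ltW t0)//.
have := @block_vectorX R mu y m0 N q l m0_gt0 (w0 _) lN.
rewrite /block_vector lN => ->.
rewrite ler_pdivrMr ?wprod_gt0//; apply: le_trans (yY _) _; apply: le_trans YB _.
by rewrite ler_pM2l ?exprn_gt0// PB.
Qed.

(** The shift by [N * i0] brings block [i0] to the front. For [j < N] the error is [y j] times a
    ratio of products minus one. For [j >= N] the target is 0 and only a later block can contribute;
    there [wprod W j] is at least [D], not just [c]. *)
Lemma block_vector_error (R : realType) (mu : nat -> nat -> R) (W : nat -> R) y m0 N q i0
    (c D h tau : R) j l :
  (0 < m0)%N -> (0 < i0 <= q)%N -> (forall i, weight (mu i)) -> weight W ->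
  0 < c -> 0 < D -> 0 <= h -> 0 <= tau ->
  (forall j, (N <= j)%N -> y j = 0) ->
  (forall j, c <= wprod W j) ->
  (forall j, (N <= j)%N -> D <= wprod W j) ->
  (forall l, (N <= l < N * q.+1)%N -> wprod W l / wprod (mu (l %/ N)%N) l <= h) ->
  (forall l, (N <= l < N * q.+1)%N -> `|wprod W l / wprod (mu i0) l - 1| <= tau) ->
  l = (j + N * i0)%N ->
  normc ((wprod W j)^-1%:C *
     ((wprod W l)%:C * block_vector mu y m0 N q l ^+ m0 - y j)) <=
  tau / c * normc (y j) +
  h / D * (if (l < N * q.+1)%N then normc (y (l %% N)%N) else 0).
Proof.
move=> m0_gt0 /andP[i0_gt0 i0q] mu0 W0 c0 D0 h0 tau0 yN Wc WD Wh Wtau lE.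
have P0 j' : 0 < wprod W j' by exact: wprod_gt0.
rewrite normcM normc_real ger0_norm ?invr_ge0 ?(ltW (P0 j))//.
have Nl : (N <= l)%N by rewrite lE (leq_trans (leq_pmulr N i0_gt0))// leq_addl.
have hD0 : 0 <= h / D by rewrite divr_ge0// ltW.
have tc0 : 0 <= tau / c by rewrite divr_ge0// ltW.
have [jN|Nj] := ltnP j N.
  have N0 : (0 < N)%N by exact: leq_ltn_trans jN.
  have lmod : (l %% N = j)%N by rewrite lE addnC mulnC modnMDl modn_small.
  have ldiv : (l %/ N = i0)%N by rewrite lE addnC mulnC divnMDl// divn_small// addn0.
  have lN : (N <= l < N * q.+1)%N.
    rewrite Nl mulnS lE -addSn leq_add//.
    by rewrite leq_mul2l i0q orbT.
  have -> : (wprod W l)%:C * block_vector mu y m0 N q l ^+ m0 - y j =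
      (wprod W l / wprod (mu i0) l - 1)%:C * y j.
    rewrite /block_vector lN rootCK// lmod ldiv rmorphB/= rmorphM/= fmorphV rmorph1; ring.
  rewrite normcM normc_real mulrA.
  apply: (@le_trans _ _ (tau / c * normc (y j))).
    rewrite ler_wpM2r ?normc_ge0// mulrC ler_pM ?invr_ge0 ?(ltW (P0 j))//.
    - exact: Wtau.
    - by rewrite lef_pV2 ?posrE// P0.
  by rewrite lerDl mulr_ge0//; case: ifP; rewrite ?normc_ge0.
rewrite yN// subr0 normc0 mulr0 add0r normcM normc_real ger0_norm ?(ltW (P0 l))// normcX.
case: ifPn => [lN|lN]; last first.
  by rewrite /block_vector (negbTE lN) andbF normc0 expr0n gtn_eqF// !mulr0.
rewrite block_vectorX ?Nl// mulrA [_ * (_ / _)]mulrCA mulrA [X in X <= _](_ : _ =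
  (wprod W l / wprod (mu (l %/ N)%N) l) * (wprod W j)^-1 * normc (y (l %% N)%N)); last by ring.
rewrite ler_wpM2r ?normc_ge0// ler_pM ?invr_ge0 ?(ltW (P0 j)) ?divr_ge0 ?(ltW (P0 l))//.
- by rewrite ltW ?wprod_gt0.
- by rewrite Wh// Nl.
- by rewrite lef_pV2 ?posrE// WD.
Qed.

(** Sums the coordinate errors. Past the blocks [u] has [l^1] mass at most [e <= 1]; there
    [|u| ^ m0 <= |u|], and ratios of products are at most [C ^ (N * q.+1)]. For the power [m0.+1],
    one factor [|u|] is summed to at most [B] while the other [m0] are bounded uniformly. *)
Lemma block_vector_approx (R : realType) (mu : nat -> nat -> R) (W : nat -> R)
    (y u : nat -> R[i]) m0 N q i0 L (c D h tau C S Y B e : R) :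
  (0 < m0)%N -> (L <= N)%N -> (0 < i0 <= q)%N -> (forall i, weight (mu i)) -> weight W ->
  0 < c -> 0 < D -> 0 <= h -> 0 <= tau -> 1 <= C -> e <= 1 ->
  (forall j, (L <= j)%N -> y j = 0) ->
  (forall j, normc (y j) <= Y) -> \sum_(0 <= j < L) normc (y j) <= S ->
  (forall j, (1 <= j)%N -> W j <= C) ->
  (forall j, c <= wprod W j) ->
  (forall j, (N <= j)%N -> D <= wprod W j) ->
  (forall l, (N <= l < N * q.+1)%N -> wprod W l / wprod (mu (l %/ N)%N) l <= h) ->
  (forall l, (N <= l < N * q.+1)%N -> `|wprod W l / wprod (mu i0) l - 1| <= tau) ->
  (forall l, (N <= l < N * q.+1)%N -> u l = block_vector mu y m0 N q l) ->
  \sum_(0 <= l < N * q.+1) normc (block_vector mu y m0 N q l) <= B ->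
  (forall M, \sum_(N * q.+1 <= l < M) normc (u l) <= e) ->
  forall M,
    \sum_(0 <= j < M) normc ((wprod W j)^-1%:C *
       ((wprod W (j + N * i0)%N)%:C * u (j + N * i0)%N ^+ m0 - y j)) <=
      tau / c * S + h / D * (q.+1%:R * S) + C ^+ (N * q.+1) * e /\
    \sum_(0 <= j < M) (wprod W j)^-1 * wprod W (j + N * i0)%N *
       normc (u (j + N * i0)%N) ^+ m0.+1 <=
      (tau / c * Y + h / D * Y + Y / c) * B + C ^+ (N * q.+1) * e.
Proof.
move=> m0_gt0 LN i0q mu0 W0 c0 D0 h0 tau0 C1 e1 yL yY yS WC Wc WD Wh Wtau ub bB ue M.
set n := (N * i0)%N; set n' := (N * q.+1)%N.
have [i0_gt0 i0_leq] := andP i0q.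
have C0 : 0 < C by lra.
have hD0 : 0 <= h / D by rewrite divr_ge0// ltW.
have tc0 : 0 <= tau / c by rewrite divr_ge0// ltW.
have Nn : (N <= n)%N by rewrite leq_pmulr.
have nn' : (n + N <= n')%N by rewrite /n /n' mulnS addnC leq_add// leq_mul2l i0_leq orbT.
have P0 j : 0 < wprod W j by exact: wprod_gt0.
have S_M Q : \sum_(0 <= j < Q) normc (y j) <= S.
  apply: le_trans yS; apply: sum_le_support => // j; first exact: normc_ge0.
  by move=> /yL ->; rewrite normc0.
have utail M' l : (n' <= l < M')%N -> normc (u l) <= e.
  move=> /andP[n'l lM]; apply: le_trans (ue l.+1).
  by rewrite big_nat_recr//= lerDr sumr_ge0// => i _; exact: normc_ge0.
have PPC j : (wprod W j)^-1 * wprod W (j + n)%N <= C ^+ n'.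
  apply: le_trans (wprod_ratio_le _ _ W0 WC) _.
  by apply: ler_weXn2l => //; exact: leq_trans (leq_addr _ _) nn'.
have PP0 j : 0 <= (wprod W j)^-1 * wprod W (j + n)%N.
  by rewrite mulr_ge0 ?invr_ge0 ?(ltW (P0 _)).
(* [near] majorises what the blocks contribute, [far] is the small tail of [u]. *)
pose near l : R := if (l < n')%N then normc (y (l %% N)%N) else 0.
pose far l : R := if (l < n')%N then 0 else normc (u l).
have near0 l : 0 <= near l by rewrite /near; case: ifP => // _; exact: normc_ge0.
have far0 l : 0 <= far l by rewrite /far; case: ifP => // _; exact: normc_ge0.
have nearS Q : \sum_(0 <= j < Q) near (j + n)%N <= q.+1%:R * S.
  apply: le_trans (sum_shift_le _ near0 (leq0n n)) _.
  apply: le_trans (@sum_le_support _ near n' _ near0 _) _.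
    by move=> j; rewrite /near ltnNge => ->.
  rewrite (eq_big_nat _ _ (F2 := fun l => normc (y (l %% N)%N))).
    by rewrite (sum_modn (fun j => normc (y j))) ler_wpM2l.
  by move=> l /andP[_ ln']; rewrite /near ln'.
have fare Q : \sum_(0 <= j < Q) far (j + n)%N <= e.
  apply: le_trans (sum_shift_le _ far0 (leq0n n)) _.
  apply: (@le_trans _ _ (\sum_(n' <= l < maxn n' (Q + n)) far l)); last first.
    apply: le_trans (ue (maxn n' (Q + n))); apply: ler_sum_nat => l /andP[n'l _].
    by rewrite /far ltnNge n'l.
  have [n'Q|Qn'] := leqP n' (Q + n)%N.
    rewrite (big_cat_nat (leq0n n') n'Q)/=.
    rewrite (_ : \sum_(0 <= i < n') far i = 0) ?add0r//.
    by rewrite big_nat_cond big1// => l; rewrite andbT /far => /andP[_ ->].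
  rewrite [leRHS]big_geq// big_nat_cond big1// => l.
  by rewrite andbT /far => lQ; rewrite (leq_trans _ (ltnW Qn')).
have berr j := @block_vector_error R mu W y m0 N q i0 c D h tau j _ m0_gt0 i0q mu0 W0 c0 D0 h0
  tau0 (fun j Nj => yL j (leq_trans LN Nj)) Wc WD Wh Wtau erefl.
have uu j : (n' <= j + n)%N -> normc (u (j + n)%N) ^+ m0 <= normc (u (j + n)%N).
  move=> n'l; rewrite -[leRHS]expr1; apply: ler_wiXn2l => //; first exact: normc_ge0.
  by apply: le_trans e1; apply: (@utail (j + n).+1); rewrite n'l/=.
have err j : normc ((wprod W j)^-1%:C * ((wprod W (j + n)%N)%:C * u (j + n)%N ^+ m0 - y j)) <=
    tau / c * normc (y j) + h / D * near (j + n)%N + C ^+ n' * far (j + n)%N.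
  have Nl : (N <= j + n)%N by exact: leq_trans Nn (leq_addl _ _).
  have [ln'|n'l] := ltnP (j + n)%N n'.
    have lN : (N <= j + n < n')%N by rewrite Nl.
    by rewrite (ub _ lN) /far ln' mulr0 addr0 /near; exact: berr.
  have Nj : (N <= j)%N by rewrite -(leq_add2r n) addnC (leq_trans nn').
  rewrite (yL j (leq_trans LN Nj)) subr0 normc0 mulr0 add0r /near /far ltnNge n'l/= mulr0 add0r.
  rewrite mulrA !normcM !normc_real !ger0_norm ?invr_ge0 ?(ltW (P0 _))// normcX.
  by apply: ler_pM => //; [exact: exprn_ge0 (normc_ge0 _)|exact: uu].
split.
  apply: (@le_trans _ _ (\sum_(0 <= j < M)
      (tau / c * normc (y j) + h / D * near (j + n)%N + C ^+ n' * far (j + n)%N))).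
    by apply: ler_sum => j _; exact: err.
  rewrite !big_split/= -!mulr_sumr lerD ?lerD//.
  - by rewrite ler_wpM2l.
  - by rewrite ler_wpM2l.
  - by rewrite ler_wpM2l// exprn_ge0// ltW.
set H := (X in X * B).
have Y0 : 0 <= Y by apply: le_trans (yY 0%N); exact: normc_ge0.
have H0 : 0 <= H by rewrite /H !addr_ge0 ?mulr_ge0// ?invr_ge0 ltW.
have nb0 l : 0 <= normc (block_vector mu y m0 N q l) by exact: normc_ge0.
pose nearb l := if (l < n')%N then normc (block_vector mu y m0 N q l) else 0.
have nearb0 l : 0 <= nearb l by rewrite /nearb; case: ifP.
have nearbB Q : \sum_(0 <= j < Q) nearb (j + n)%N <= B.
  apply: le_trans (sum_shift_le _ nearb0 (leq0n n)) _.
  apply: le_trans (@sum_le_support _ nearb n' _ nearb0 _) _.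
    by move=> j; rewrite /nearb ltnNge => ->.
  apply: le_trans bB; apply: ler_sum_nat => l /andP[_ ln'].
  by rewrite /nearb ln'.
apply: (@le_trans _ _ (\sum_(0 <= j < M) (H * nearb (j + n)%N + C ^+ n' * far (j + n)%N))).
  apply: ler_sum => j _; rewrite exprSr mulrA.
  have Nl : (N <= j + n)%N by exact: leq_trans Nn (leq_addl _ _).
  have [ln'|n'l] := ltnP (j + n)%N n'.
    have lN : (N <= j + n < n')%N by rewrite Nl.
    rewrite (ub _ lN) /far ln' mulr0 addr0 /nearb ln' ler_wpM2r//.
    have := berr j; rewrite -/n -/n' ln'.
    set b := block_vector _ _ _ _ _ _ => bj.
    have -> : (wprod W j)^-1 * wprod W (j + n)%N * normc b ^+ m0 =
       normc ((wprod W j)^-1%:C * ((wprod W (j + n)%N)%:C * b ^+ m0)).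
      by rewrite mulrA !normcM !normc_real !ger0_norm ?invr_ge0 ?(ltW (P0 _))// normcX.
    (* The power of [b] is at most its distance to the target plus the target itself. *)
    apply: le_trans (normc_le_subD _ ((wprod W j)^-1%:C * y j)) _.
    rewrite -mulrBr; apply: lerD.
      apply: le_trans bj _; apply: lerD; rewrite ler_wpM2l//.
    rewrite normcM normc_real ger0_norm ?invr_ge0 ?(ltW (P0 _))// mulrC.
    by apply: ler_pM; rewrite ?normc_ge0 ?invr_ge0 ?(ltW (P0 _))// lef_pV2 ?posrE// P0.
  rewrite /nearb /far ltnNge n'l/= mulr0 add0r.
  rewrite ler_wpM2r ?normc_ge0//.
  apply: le_trans (_ : C ^+ n' * 1 <= _); last by rewrite mulr1.
  apply: ler_pM => //; first exact: exprn_ge0 (normc_ge0 _).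
  apply: le_trans (uu _ n'l) _; apply: le_trans e1.
  by apply: (@utail (j + n).+1); rewrite n'l/=.
rewrite big_split/= -!mulr_sumr lerD// ler_wpM2l//.
by rewrite exprn_ge0// ltW.
Qed.

(** * One task on a small cube of parameters *)

Lemma unit_cell (R : realType) (m : nat) (x : R) : (0 < m)%N -> 0 <= x <= m%:R ->
  exists2 t, (t < m)%N & t%:R <= x <= t.+1%:R.
Proof.
case: m => // m _; elim: m => [|m IH] xm; first by exists 0%N.
have [mx|xm'] := leP m.+1%:R x; first by exists m.+1; rewrite // mx; case/andP: xm.
have [|t tm tx] := IH; first by rewrite (ltW xm') andbT; case/andP: xm.
by exists t => //; exact: ltnW.
Qed.

(** The net must consist of points of [Q], where the weights are controlled: a cell of length
    [rho / m] meeting [Q] provides one of its points in [Q], and a cell missing [Q] receives the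
    default [a0]. *)
Lemma fine_net (R : realType) (Q : set R) (a0 c rho : R) (m : nat) :
  0 < rho -> (0 < m)%N -> Q a0 -> (forall a, Q a -> c <= a <= c + rho) ->
  exists2 p : nat -> R, (forall t, Q (p t)) &
    forall a, Q a -> exists2 t, (t < m)%N & `|a - p t| <= rho / m%:R.
Proof.
move=> rho0 m0 Qa0 Qc.
have m0R : 0 < m%:R :> R by rewrite ltr0n.
pose cell t a := Q a /\ t%:R <= (a - c) * m%:R / rho <= t.+1%:R.
have /choice[p pP] t : exists b, Q b /\ forall a, cell t a -> `|a - b| <= rho / m%:R.
  have [[b [Qb bt]]|no] := pselect (exists b, cell t b); last first.
    by exists a0; split=> // a /(ex_intro _ a)/no.
  exists b; split=> // a [_ at_].
  have e (z : R) : z - c = (z - c) * m%:R / rho * (rho / m%:R).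
    by field; rewrite !gt_eqF.
  have -> : a - b = ((a - c) * m%:R / rho - (b - c) * m%:R / rho) * (rho / m%:R).
    by rewrite mulrBl -!e; ring.
  have r0 : 0 < rho / m%:R by rewrite divr_gt0.
  rewrite normrM (ger0_norm (ltW r0)) ler_piMl ?(ltW r0)//.
  move: bt at_; rewrite -addn1 natrD => /andP[b1 b2] /andP[a1 a2].
  by rewrite ler_norml; apply/andP; split; lra.
exists p => [t|a Qa]; first by case: (pP t).
have [|t tm ta] := @unit_cell R m ((a - c) * m%:R / rho) m0.
  have /andP[ca ac] := Qc a Qa.
  rewrite divr_ge0 ?mulr_ge0 ?subr_ge0// ?(ltW rho0)//=.
  by rewrite ler_pdivrMr// mulrC ler_pM2l// lerBlDl.
by exists t => //; have [_] := pP t; apply.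
Qed.

(* Dividing the target [y k j] by [wprod (W k) j] makes a task independent of the
   parameter: [block_vector] then only involves [wprod] at large indices. *)
Definition approximates (R : realType) (J : Type) (W : J -> nat -> R) (m0 : nat)
    (y : J -> nat -> R[i]) (eps : R) (u : J -> nat -> R[i]) :=
  exists2 n, (1 <= n)%N & forall k M,
    \sum_(0 <= j < M) normc ((wprod (W k) j)^-1%:C *
       ((wprod (W k) (j + n)%N)%:C * u k (j + n)%N ^+ m0 - y k j)) <= eps /\
    \sum_(0 <= j < M) (wprod (W k) j)^-1 * wprod (W k) (j + n)%N *
       normc (u k (j + n)%N) ^+ m0.+1 <= eps.

(** Constants are chosen in the order [x], then [m], [N], [theta], then [e']; coming after the end
    [n'] of the blocks, [e'] can absorb [C ^ n']. The condition [D1 * rho <= gamma / 2] keeps ratios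
    of products over the whole cube below [n' ^ (gamma / 2)]. *)
Lemma approximation_step (R : realType) (d : nat) (w : R -> nat -> R)
    (Q : 'I_d -> set R) (a0 c : 'I_d -> R) (rho C D1 D2 gamma : R) (N0 L m0 : nat)
    (y : 'I_d -> nat -> R[i]) (eps : R) (f : 'I_d -> nat -> R[i]) n (e : R) :
  1 <= C -> 0 < gamma -> 0 < D1 -> 0 < D2 -> 0 < rho -> D1 * rho <= gamma / 2 ->
  (0 < m0)%N -> 0 < eps -> 0 < e ->
  (forall k, Q k (a0 k)) ->
  (forall k a, Q k a -> c k <= a <= c k + rho) ->
  (forall k a, Q k a -> weight (w a)) ->
  (forall k a, Q k a -> forall i, (1 <= i)%N -> w a i <= C) ->
  (forall k a b N, Q k a -> Q k b -> (N0 <= N)%N ->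
    `|ln (wprod (w a) N) - ln (wprod (w b) N)| <= D1 * ln N%:R * `|a - b|) ->
  (forall k a N, Q k a -> (N0 <= N)%N -> D2 * N%:R `^ gamma <= wprod (w a) N) ->
  (forall k j, (L <= j)%N -> y k j = 0) ->
  exists f' n' e', [/\ 0 < e', (n < n')%N,
    cylinder f' n' e' `<=` cylinder f n e &
    cylinder f' n' e' `<=` [set u | forall lam : 'I_d -> R,
      (forall k, Q k (lam k)) -> approximates (fun k => w (lam k)) m0 y eps u]].
Proof.
move=> C1 g0 D10 D20 rho0 D1rho m0_gt0 eps0 e0 Qa0 Qc Qw QC Qln QD yL.
have C0 : 0 < C by lra.
pose c0 := D2 / C ^+ N0.+1.
have c00 : 0 < c0 by rewrite divr_gt0// exprn_gt0.
pose S := \sum_k \sum_(0 <= j < L) normc (y k j).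
have Sk0 k : 0 <= \sum_(0 <= j < L) normc (y k j).
  by rewrite sumr_ge0// => j _; exact: normc_ge0.
have yS k : \sum_(0 <= j < L) normc (y k j) <= S.
  by rewrite /S (bigD1 k)//= lerDl sumr_ge0.
have S0 : 0 <= S by exact: sumr_ge0.
have yjS k j : normc (y k j) <= S.
  have [jL|/yL ->] := ltnP j L; last by rewrite normc0.
  apply: le_trans (yS k); rewrite (big_cat_nat (leq0n j) (ltnW jL))/= (big_ltn jL).
  by rewrite addrCA lerDl addr_ge0// sumr_ge0// => i _; exact: normc_ge0.
(* [dl] bounds each error term: at most a third of [eps] and half of the tail budget [e]. *)
pose dl := Num.min (Num.min (eps / 3) (e / 2)) 1.
have dl0 : 0 < dl by rewrite !lt_min !divr_gt0 ?ltr01.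
have [dl1 dl2 dl3] : [/\ dl <= eps / 3, dl <= e / 2 & dl <= 1].
  by rewrite /dl !ge_min !lexx ?orbT.
pose K2 := (S / c0 + S / D2 + S / c0) * L%:R.
have Sc0 : 0 <= S / c0 by rewrite divr_ge0// ltW.
have SD0 : 0 <= S / D2 by rewrite divr_ge0// ltW.
have K20 : 0 <= K2 by rewrite /K2 mulr_ge0 ?addr_ge0.
pose K := S / c0 + S / D2 + K2 + L%:R.
have L0 : 0 <= L%:R :> R by [].
(* [K] dominates the constants that will multiply [x], so [x] times each of them is at most [dl]. *)
have K0 : 0 <= K by rewrite /K !addr_ge0.
pose x := dl / (1 + K).
have K_ge : [/\ S / c0 <= K, S / D2 <= K, K2 <= K & L%:R <= K].
  by move: Sc0 SD0 K20 L0; rewrite /K; clearbody K2; clear; split; lra.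
have [ScK SDK K2K LK] := K_ge.
have x0 : 0 < x by rewrite divr_gt0//; lra.
have xK : x * (1 + K) = dl by rewrite /x divfK// gt_eqF//; lra.
have xKle z : 0 <= z -> z <= K -> x * z <= dl.
  by move=> z0 zK; rewrite -xK ler_pM2l//; lra.
have x_dl : x <= dl by rewrite -xK ler_peMr ?(ltW x0)//; lra.
(* [N > n + L + N0] puts the blocks past the prescribed coordinates and past [N0], and makes them
   longer than the support of the target. *)
have [m [N [theta [[mgt0 N_gt] hln [theta0 htheta] hY hh]]]] :=
  @mesh_parameters R d m0 (n + L + N0) gamma (D1 * rho) D2 S (x / 2) x m0_gt0 g0
  (ltW (mulr_gt0 D10 rho0)) D20 S0 (divr_gt0 x0 (ltr0Sn _ _)) x0.
set q := (m ^ d)%N in hln htheta hh; set n' := (N * q.+1)%N in hln hh.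
have [nN LN N0N Ngt0] : [/\ (n < N)%N, (L <= N)%N, (N0 <= N)%N & (0 < N)%N] by clear -N_gt; split; lia.
have Nn' : (N <= n')%N by rewrite leq_pmulr.
have NR : 0 < N%:R :> R by rewrite ltr0n.
pose D := D2 * N%:R `^ gamma; have D0 : 0 < D by rewrite mulr_gt0 ?powR_gt0.
have PD k a l : Q k a -> (N <= l)%N -> D <= wprod (w a) l.
  move=> Qa Nl; apply: le_trans (QD k a l Qa (leq_trans N0N Nl)).
  by rewrite ler_pM2l// ge0_ler_powR ?nnegrE ?(ltW g0)// ler_nat.
pose h := n'%:R `^ (gamma / 2); have h0 : 0 <= h by exact: powR_ge0.
have lnl l : (N <= l < n')%N -> 0 <= ln (l%:R : R) <= ln n'%:R.
  move=> /andP[Nl ln']; have l0 := leq_trans Ngt0 Nl.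
  by rewrite ln_ge0 ?ler1n// ler_ln ?posrE ?ltr0n ?(leq_trans l0 (ltnW ln'))// ler_nat ltnW.
have Qh k a b l : Q k a -> Q k b -> (N <= l < n')%N -> wprod (w a) l / wprod (w b) l <= h.
  move=> Qa Qb ll; have /andP[Nl ln'] := ll; have /andP[l1 l2] := lnl l ll.
  rewrite /h /powR gt_eqF ?ltr0n ?(leq_trans Ngt0)//.
  apply: ratio_le_expR; rewrite ?wprod_gt0//; [exact: Qw Qa|exact: Qw Qb|].
  apply: le_trans (Qln k a b l Qa Qb (leq_trans N0N Nl)) _.
  have ab : `|a - b| <= rho.
    by move: (Qc k a Qa) (Qc k b Qb); rewrite ler_norml; clear; lra.
  apply: (@le_trans _ _ (D1 * ln l%:R * rho)).
    by rewrite ler_wpM2l// mulr_ge0// ltW.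
  by rewrite mulrAC ler_pM// mulr_ge0// ltW.
have /choice[p pP] k : exists p : nat -> R, (forall t, Q k (p t)) /\
    forall a, Q k a -> exists2 t, (t < m)%N & `|a - p t| <= rho / m%:R.
  by have [p p1 p2] := @fine_net R (Q k) (a0 k) (c k) rho m rho0 mgt0 (Qa0 k) (Qc k); exists p.
(* Each block serves one cell of the cube, given by its tuple of indices; [i.-1] below because
   blocks are numbered from 1. *)
pose G := enum {: {ffun 'I_d -> 'I_m}}.
pose grid i := nth [ffun=> Ordinal mgt0] G i.-1.
pose mu (k : 'I_d) i := w (p k (grid i k)).
have muw k i : weight (mu k i) by apply: (Qw k); case: (pP k).
pose b k l := block_vector (mu k) (y k) m0 N q l.
have bsum k : \sum_(0 <= l < n') normc (b k l) <= x * L%:R.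
  apply: le_trans (@block_vector_sum_le R (mu k) (y k) m0 N q L theta S D m0_gt0 LN (muw k)
    theta0 D0 (yjS k) (yL k) hY _) _.
    by move=> l /andP[Nl _]; apply: (PD k) => //; case: (pP k).
  by rewrite mulrCA [x * _]mulrC ler_wpM2l// mulrC.
pose e' := Num.min (Num.min (e / 2) 1) (eps / 3 / C ^+ n').
have Cn0 : 0 < C ^+ n' by exact: exprn_gt0.
have e'0 : 0 < e' by rewrite !lt_min !divr_gt0 ?ltr01.
have [e'1 e'2 e'3] : [/\ e' <= e / 2, e' <= 1 & e' <= eps / 3 / C ^+ n'].
  by rewrite /e' !ge_min !lexx ?orbT.
have Ce' : C ^+ n' * e' <= eps / 3 by rewrite mulrC -ler_pdivlMr.
exists (fun k l => if (l < n)%N then f k l else b k l), n', e'.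
split=> //; first exact: leq_trans nN Nn'.
  move=> u [u1 u2]; split=> [k j jn|k M].
    by rewrite u1 ?jn// (leq_trans jn)// (leq_trans (ltnW nN)).
  have nn' : (n <= n')%N by rewrite (leq_trans (ltnW nN)).
  (* Enlarging [M] allows a split at [n']: block vector before it, new tail after it. *)
  apply: (@le_trans _ _ (\sum_(n <= j < maxn n' M) normc (u k j))).
    have [nM|Mn] := leqP n M; last first.
      by rewrite big_geq ?(ltnW Mn)// sumr_ge0// => j _; exact: normc_ge0.
    rewrite (big_cat_nat nM (leq_maxr n' M))/= lerDl sumr_ge0// => j _.
    exact: normc_ge0.
  rewrite (big_cat_nat nn' (leq_maxl n' M))/= (splitr e); apply: lerD; last first.
    exact: le_trans (u2 _ _) e'1.
  apply: (@le_trans _ _ (\sum_(0 <= l < n') normc (b k l))).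
    rewrite (big_cat_nat (leq0n n) nn')/= -[leLHS]add0r lerD ?sumr_ge0//.
      by move=> j _; exact: normc_ge0.
    by apply: ler_sum_nat => j /andP[nj jn']; rewrite u1// ltnNge nj.
  exact: le_trans (bsum k) (le_trans (xKle _ L0 LK) dl2).
move=> u [u1 u2] lam Qlam.
have /choice[t tP] k : exists t : 'I_m, `|lam k - p k t| <= rho / m%:R.
  by have [_ /(_ _ (Qlam k))[t tm ht]] := pP k; exists (Ordinal tm).
pose g := [ffun k => t k].
(* The block assigned to the cell containing [lam]. *)
pose i0 := (index g G).+1.
have i0q : (0 < i0 <= q)%N.
  rewrite /i0 /=; have : (index g G < size G)%N by rewrite index_mem mem_enum.
  by rewrite -cardE card_ffun !card_ord.
have gridE : grid i0 = g by rewrite /grid /= nth_index// mem_enum.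
have tau0 k l : (N <= l < n')%N -> `|wprod (w (lam k)) l / wprod (mu k i0) l - 1| <= x.
  move=> ll; have /andP[Nl ln'] := ll; have /andP[l1 l2] := lnl l ll.
  (* The mesh bounds the difference of logarithms by [x / 2], hence the ratio minus one by [x]. *)
  rewrite -[x](@divfK _ 2)// [_ * 2]mulrC.
  apply: ratio_near1; rewrite ?wprod_gt0//; first exact: Qw (Qlam k).
    by rewrite ler_pM2r ?invr_gt0// (le_trans x_dl).
  have Qpk : Q k (p k (grid i0 k)) by case: (pP k).
  apply: le_trans (Qln k _ _ l (Qlam k) Qpk (leq_trans N0N Nl)) _.
  rewrite gridE /g ffunE; apply: le_trans hln.
  apply: (@le_trans _ _ (D1 * ln l%:R * (rho / m%:R))).
    by rewrite ler_wpM2l// mulr_ge0// ltW.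
  rewrite [leRHS](_ : _ = D1 * ln n'%:R * (rho / m%:R)); last by ring.
  rewrite ler_wpM2r ?divr_ge0 ?(ltW rho0)//.
  by rewrite ler_wpM2l// ltW.
have hD : h / D * q.+1%:R <= x / D2.
  have -> : h / D * q.+1%:R = h * q.+1%:R / N%:R `^ gamma / D2 by rewrite /D invfM; ring.
  by rewrite ler_pM2r ?invr_gt0// ler_pdivrMr ?powR_gt0.
have hD' : h / D <= 1 / D2.
  apply: le_trans (le_trans _ hD) _.
    by rewrite ler_peMr ?ler1n// divr_ge0// ltW.
  by rewrite ler_pM2r ?invr_gt0// (le_trans x_dl).
exists (N * i0)%N; first by rewrite muln_gt0 Ngt0.
move=> k M.
have ub l : (N <= l < n')%N -> u k l = b k l.
  by move=> /andP[Nl ln']; rewrite u1// ltnNge (leq_trans (ltnW nN) Nl).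
have Wl j : c0 <= wprod (w (lam k)) j.
  apply: (@wprod_ge R (w (lam k)) C D2 gamma N0 j) => //.
  - exact: Qw (Qlam k).
  - exact: QC (Qlam k).
  - exact: ltW.
  - by move=> j' N0j'; exact: QD (Qlam k) N0j'.
have [] := @block_vector_approx R (mu k) (w (lam k)) (y k) (u k) m0 N q i0 L c0 D h x C S S
  (x * L%:R) e' m0_gt0 LN i0q (muw k) (Qw k _ (Qlam k)) c00 D0 h0 (ltW x0) C1 e'2 (yL k) (yjS k)
  (yS k) (QC k _ (Qlam k)) Wl (fun j Nj => PD k _ j (Qlam k) Nj) _ (tau0 k) ub (bsum k) (u2 k) M.
  by move=> l ll; apply: (Qh k) => //; case: (pP k).
move=> E1 E2; split.
  apply: le_trans E1 _; rewrite -/n'.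
  have h1 : x / c0 * S <= dl.
    by rewrite -mulrA [c0^-1 * S]mulrC; exact: xKle.
  have h2 : h / D * (q.+1%:R * S) <= dl.
    rewrite mulrA; apply: le_trans (_ : x / D2 * S <= _); first by rewrite ler_wpM2r.
    by rewrite -mulrA [D2^-1 * S]mulrC; exact: xKle.
  apply: (@le_trans _ _ (dl + dl + eps / 3)); first by rewrite !lerD.
  by move: dl1; clearbody dl; clear; lra.
apply: le_trans E2 _; rewrite -/n'.
have h1 : (x / c0 * S + h / D * S + S / c0) * (x * L%:R) <= x * K2.
  rewrite mulrCA ler_pM2l// /K2 ler_wpM2r// lerD// lerD//.
    by rewrite -mulrA [c0^-1 * S]mulrC ler_piMl// (le_trans x_dl).
  by rewrite [S / D2]mulrC -[D2^-1]div1r ler_wpM2r.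
have h2 : x * K2 <= dl by exact: xKle.
apply: (@le_trans _ _ (dl + eps / 3)); first by rewrite lerD// (le_trans h1).
by move: dl1 eps0; clearbody dl; clear; lra.
Qed.

(** * Neighbourhoods in the power and norms of sequences *)

(** The boxes around [v] generate a filter that converges in each coordinate, hence in the product
    topology, so [O] belongs to it. *)
Lemma power_ball (K : numFieldType) (V : normedModType K) (d : nat)
    (O : set (power d V)) (v : power d V) :
  open O -> O v ->
  exists2 e : K, 0 < e & forall y : power d V, (forall k, `|v k - y k| < e) -> O y.
Proof.
move=> oO Ov.
pose B (e : K) : set (power d V) := [set y | forall k, `|v k - y k| < e].
pose F : set_system (power d V) := filter_from [set e | 0 < e] B.
have FF : Filter F.
  apply: filter_from_filter; first by exists 1 => /=.
  (* A positive lower bound of both radii; [K] is not assumed totally ordered, so it replaces their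
     minimum. *)
  move=> a b /= a0 b0; exists (a * b / (a + b)) => /=.
    by rewrite divr_gt0 ?mulr_gt0 ?addr_gt0.
  have le1 : a * b / (a + b) <= a.
    by rewrite ler_pdivrMr ?addr_gt0// ler_pM2l// lerDr ltW.
  have le2 : a * b / (a + b) <= b.
    by rewrite ler_pdivrMr ?addr_gt0// [leLHS]mulrC ler_pM2l// lerDl ltW.
  by move=> y yB; split=> k; [exact: lt_le_trans (yB k) le1|exact: lt_le_trans (yB k) le2].
have Fv : F --> (v : {ptws 'I_d -> V}).
  apply/cvg_sup => k A; rewrite nbhsE => -[_ [[C oC <-] Cv] CA].
  have /nbhs_ballP[e /= e0 eC] : nbhs (v k) C by exact: open_nbhs_nbhs.
  exists e => // y yB; apply: CA; apply: eC; rewrite -ball_normE; exact: yB.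
have [e e0 eO] : F O by apply: Fv; exact: open_nbhs_nbhs.
by exists e.
Qed.

(** Every modulus is at most [B], so [|x_j| ^ p <= |x_j| * B ^ (p - 1)], which sums to at most
    [B ^ p]; for [c0], terms of a convergent series tend to 0. This allows all errors to be measured
    in [l^1]. *)
Lemma l1_in_seqspace (R : realType) (X : seqspace R) (x : nat -> R[i]) (B : R) :
  (forall M, \sum_(0 <= j < M) normc (x j) <= B) ->
  x \in in_seqspace X /\ seqnorm X x <= B.
Proof.
move=> xB.
have xj j : normc (x j) <= B.
  apply: le_trans (xB j.+1); rewrite big_nat_recr//= lerDr sumr_ge0// => i _.
  exact: normc_ge0.
have B0 : 0 <= B by have := xB 0%N; rewrite big_nil.
case: X => [p p1|]; rewrite unfold_in /=.
  have p0 : 0 < p by exact: (lt_le_trans ltr01 p1).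
  have powE z : 0 <= z -> z `^ p = z * z `^ (p - 1).
    have pE : 1 + (p - 1) = p by ring.
    by move=> z0; rewrite -[X in X * _](powRr1 z0) -powRD pE// gt_eqF.
  have term j : normc (x j) `^ p <= normc (x j) * B `^ (p - 1).
    rewrite powE ?normc_ge0// ler_wpM2l ?normc_ge0//.
    by rewrite ge0_ler_powR ?nnegrE ?normc_ge0// subr_ge0.
  have le : (ell_norm p x <= B%:E)%E.
    rewrite ell_normE// -(powR_inv_id p1 B0) -poweR_EFin.
    have s0 : (0 <= \sum_(n <oo) (normc (x n) `^ p)%:E)%E.
      by apply: nneseries_ge0 => n _ _; rewrite lee_fin powR_ge0.
    apply: gt0_ler_poweR => //.
    - by rewrite invr_ge0 ltW.
    - by rewrite in_itv/= s0 leey.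
    - by rewrite in_itv/= lee_fin powR_ge0 leey.
    apply: lime_le; first by apply: is_cvg_nneseries => n _ _; rewrite lee_fin powR_ge0.
    apply: nearW => M; rewrite sumEFin lee_fin (powE B)//.
    apply: le_trans (_ : \sum_(0 <= j < M) (normc (x j) * B `^ (p - 1)) <= _).
      by apply: ler_sum => j _.
    by rewrite -mulr_suml ler_wpM2r ?powR_ge0.
  have fin : (ell_norm p x < +oo)%E by exact: le_lt_trans le (ltry _).
  by split=> //; rewrite -lee_fin -ell_norm_fin.
split.
  apply/asboolP; apply: cvg_series_cvg_0; apply: nondecreasing_is_cvgn.
    apply/nondecreasing_seqP => n.
    by rewrite !seriesEnat /= big_nat_recr//= lerDl normc_ge0.
  by exists B => _ [n _ <-]; rewrite seriesEnat /=; exact: xB.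
by apply: ge_sup => [|_ [n _ <-]//]; exists (normc (x 0%N)); exists 0%N.
Qed.

Definition seqtail (R : realType) (L : nat) (x : nat -> R[i]) (j : nat) : R[i] :=
  if (j < L)%N then 0 else x j.

(** Plays the role of density of finitely supported sequences. *)
Lemma seqtail_small (R : realType) (X : seqspace R) (x : nat -> R[i]) (e : R) :
  x \in in_seqspace X -> 0 < e ->
  exists L, seqtail L x \in in_seqspace X /\ seqnorm X (seqtail L x) <= e.
Proof.
move=> xX e0.
have tX L : seqtail L x \in in_seqspace X.
  have := @seqnorm_dom R X (seqtail L x) x 1 ler01 xX; case=> // n.
  by rewrite mul1r /seqtail; case: ifP => // _; rewrite normc0 normc_ge0.
suff [L h] : exists L, seqnorm X (seqtail L x) <= e by exists L.
move: xX tX; case: X => [p p1|]; rewrite unfold_in /= => xX tX.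
  have p0 : 0 < p by exact: (lt_le_trans ltr01 p1).
  have f0 n : (0 <= (normc (x n) `^ p)%:E)%E by rewrite lee_fin powR_ge0.
  have xp : (\sum_(n <oo) (normc (x n) `^ p)%:E < +oo)%E.
    by move: xX; rewrite ell_normE// => /lty_poweRy; apply; rewrite invr_eq0 gt_eqF.
  have ep : 0 < e `^ p by rewrite powR_gt0.
  have /fine_cvgP[fin /cvgrPdist_le /(_ _ ep) cv] :=
    nneseries_tail_cvg xp (fun n _ => f0 n).
  have [L [Lfin Lle]] : exists L,
      (\sum_(L <= n <oo) (normc (x n) `^ p)%:E)%E \is a fin_num /\
      `|0 - fine (\sum_(L <= n <oo) (normc (x n) `^ p)%:E)%E| <= e `^ p.
    near \oo => L; exists L; split; near: L; [exact: fin|exact: cv].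
  exists L; rewrite -lee_fin -ell_norm_fin; last by have := tX L; rewrite unfold_in.
  rewrite ell_normE// -(powR_inv_id p1 (ltW e0)) -poweR_EFin.
  rewrite sub0r normrN in Lle.
  have tE : (\sum_(n <oo) (normc (seqtail L x n) `^ p)%:E =
      \sum_(L <= n <oo) (normc (x n) `^ p)%:E)%E.
    rewrite eseries_cond [RHS]eseries_cond.
    rewrite eseries_mkcond [RHS]eseries_mkcond; apply: eq_eseriesr => n _ /=.
    by rewrite /seqtail ltnNge; case: leqP => // _; rewrite [normc _]normc0 powR0// gt_eqF.
  have t0 : (0 <= \sum_(L <= n <oo) (normc (x n) `^ p)%:E)%E by exact: nneseries_ge0.
  rewrite tE; apply: gt0_ler_poweR => //.
  - by rewrite invr_ge0 ltW.
  - by rewrite in_itv/= t0 leey.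
  - by rewrite in_itv/= lee_fin powR_ge0 leey.
  by rewrite -(fineK Lfin) lee_fin (le_trans (ler_norm _)).
move/asboolP: xX => /cvgrPdist_le /(_ _ e0)[L _ xL].
exists L; apply: ge_sup => [|_ [n _ <-]//].
  by exists (normc (seqtail L x 0%N)); exists 0%N.
rewrite /seqtail; case: ltnP => [_|Ln]; first by rewrite normc0 ltW.
by have := xL n Ln; rewrite /= sub0r normrN ger0_norm ?normc_ge0.
Unshelve. all: by end_near.
Qed.

(** * Weighted shifts and their iterates *)

Lemma wshiftE (R : realType) (X : seqspace R) (w : nat -> R) (x : X) j :
  admissible X w -> wshift w x j = (w j.+1)%:C * x j.+1.
Proof.
by move=> [wX _]; rewrite -[LHS]/(val (wshift w x) j) /wshift val_insubd wX.
Qed.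

(** Continuity at 0 is tested on [dr / 2] times the unit vector of index [i.+1]: it lies in the ball
    of radius [dr], so coordinate [i] of its image, [w i.+1] times [dr / 2], is less than 1. *)
Lemma admissible_bounded (R : realType) (X : seqspace R) (w : nat -> R) :
  weight w -> admissible X w -> exists C : R, forall i, (1 <= i)%N -> w i <= C.
Proof.
move=> w0 wX; have [_ /(_ 0)] := wX.
move=> /cvgrPdist_lt /(_ 1 ltr01) /nbhs_ballP[[dr di] /= d0 dP].
(* A positive element of [R[i]] has zero imaginary part. *)
have {d0} [dr0 di0] : 0 < dr /\ di = 0.
  by move: d0; rewrite ltcE /= => /andP[/eqP -> ->].
exists (2 / dr) => -[|i] // _.
pose x j : R[i] := if j == i.+1 then (dr / 2)%:C else 0.
have dr20 : 0 <= dr / 2 by rewrite divr_ge0 ?(ltW dr0).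
have [|xX xd] := @l1_in_seqspace R X x (dr / 2).
  move=> M; apply: le_trans (_ : \sum_(0 <= j < M) (if j == i.+1 then dr / 2 else 0) <= _).
    apply: ler_sum => j _; rewrite /x; case: eqP => _; last by rewrite normc0.
    by rewrite normc_real ger0_norm.
  apply: le_trans (@sum_le_support _ _ i.+2 M _ _) _.
  - by move=> j; case: ifP.
  - by move=> j ij; rewrite gtn_eqF.
  rewrite big_nat_recr//= eqxx big_nat_cond big1 ?add0r// => j.
  by rewrite andbT => ji; rewrite ltn_eqF.
have /(_ (Seqs xX)) := dP; rewrite -ball_normE /= sub0r normrN.
rewrite -[`|_|]/((seqnorm X x)%:C) di0 ltcR => /(_ (le_lt_trans xd _)).
have -> : dr / 2 < dr by lra.
move=> /(_ isT); set D := _ - _.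
rewrite -[`|D|]/((seqnorm X D)%:C) -[1]/(1%:C) ltcR.
have := seqnorm_coord_le i (seqvalP D) => /le_lt_trans/[apply].
have -> : D i = wshift w (0 : X) i - wshift w (Seqs xX) i by [].
rewrite !wshiftE//= /x eqxx mulr0 sub0r normcN normcM !normc_real.
rewrite !ger0_norm ?(ltW (w0 _ _))// => h.
by rewrite ler_pdivlMr//; lra.
Qed.

(** Multiplying coordinate [j] by the product of the first [j] weights conjugates the weighted shift
    to the unweighted one. *)
Lemma iter_wshift_prodE (R : realType) (X : seqspace R) (d : nat) (w : R -> nat -> R)
    (lam : power d R) (x : power d X) n k j :
  admissible X (w (lam k)) ->
  (wprod (w (lam k)) j)%:C * iter n (wshift_prod w lam) x k j =
  (wprod (w (lam k)) (j + n)%N)%:C * x k (j + n)%N.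
Proof.
move=> wX; elim: n j => [|n IH] j; first by rewrite addn0.
rewrite iterS {1}/wshift_prod wshiftE// mulrA -rmorphM addnS -addSn -IH.
by congr (_%:C * _); rewrite /wprod [in RHS]big_nat_recr.
Qed.

(** * Polynomials in one vector and hypercyclicity *)

Lemma poly_mul_exp_at0 (K : fieldType) (p : {poly K}) : p != 0 ->
  exists m q, p = 'X^m * q /\ q.[0] != 0.
Proof.
elim/poly_ind: p => [|p c IH]; first by rewrite eqxx.
have [->|c0 _] := eqVneq c 0; last first.
  by exists 0%N, (p * 'X + c%:P); rewrite expr0 mul1r !hornerE.
rewrite addr0 mulf_eq0 negb_or => /andP[/IH[m [q [-> q0]]] _].
by exists m.+1, q; rewrite mulrAC -exprSr.
Qed.

Lemma horner_bounded (R : realType) (p : {poly R[i]}) :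
  exists2 B : R, 0 <= B & forall z, normc z <= 1 -> normc p.[z] <= B.
Proof.
elim/poly_ind: p => [|p c [B B0 pB]].
  by exists 0 => // z _; rewrite horner0 normc0.
exists (B + normc c); first by rewrite addr_ge0 ?normc_ge0.
move=> z z1; rewrite !hornerE; apply: le_trans (le_normcD _ _) _.
rewrite lerD2r normcM -[B]mulr1 ler_pM ?normc_ge0//; exact: pB.
Qed.

Lemma horner_lipschitz0 (R : realType) (p : {poly R[i]}) :
  exists2 B : R, 0 <= B & forall z, normc z <= 1 -> normc (p.[z] - p.[0]) <= B * normc z.
Proof.
have /factor_theorem[q qE] : root (p - p.[0]%:P) 0 by rewrite rootE !hornerE subrr.
have [B B0 qB] := horner_bounded q; exists B => // z z1.
have -> : p.[z] - p.[0] = q.[z] * z.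
  by have := congr1 (horner^~ z) qE; rewrite /= hornerM hornerXsubC subr0 !hornerE.
by rewrite normcM ler_wpM2r ?normc_ge0// qB.
Qed.

(** Write [X p = X ^ (m + 1) q] with [c = q(0)] nonzero. If an iterate brings [u ^ (m + 1)] close to
    the target over [c], it brings the lowest-order part of [x] close to the target; the rest is at
    most [B |u| ^ (m + 2)], which the second bound of [approximates] makes small. Allowing [y] near
    [z] lets targets range over a countable set. *)
Lemma approximates_HC (R : realType) (X : seqspace R) (d : nat) (w : R -> nat -> R)
    (lam : power d R) (u x : power d X) (p : {poly R[i]}) :
  (forall k, weight (w (lam k))) -> (forall k, admissible X (w (lam k))) ->
  (forall k j, normc (u k j) <= 1) -> p != 0 ->
  (forall k j, x k j = ('X * p).[u k j]) ->
  (forall m0 L (z : 'I_d -> nat -> R[i]) (eta eps : R), (0 < m0)%N -> 0 < eta -> 0 < eps ->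
    (forall k j, (L <= j)%N -> z k j = 0) ->
    exists y, [/\ (forall k j, (L <= j)%N -> y k j = 0),
      (forall k j, normc (z k j - y k j) <= eta) &
      approximates (fun k => w (lam k)) m0 y eps (fun k j => u k j)]) ->
  HC (wshift_prod w lam) x.
Proof.
move=> w0 wX u1 p0 xE Happ O [v Ov] oO.
have [[er ei] e0 eO] := power_ball oO Ov.
have {e0} [er0 ei0] : 0 < er /\ ei = 0.
  by move: e0; rewrite ltcE /= => /andP[/eqP -> ->].
rewrite {}ei0 in eO.
have [m [q [pE q0]]] := poly_mul_exp_at0 p0.
set c := q.[0] in q0.
have [B B0 qB] := horner_lipschitz0 q.
have P0 k j : 0 < wprod (w (lam k)) j by exact: wprod_gt0.
have er4 : 0 < er / 4 by rewrite divr_gt0.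
have /choice[Lk LkP] k := seqtail_small (seqvalP (v k)) er4.
pose L := \max_k Lk k.
have LkL k : (Lk k <= L)%N by exact: leq_bigmax.
(* The truncated [v], rescaled to the normalisation of [approximates] and divided by the lowest
   coefficient. *)
pose z k j := if (j < Lk k)%N then (wprod (w (lam k)) j)%:C * v k j / c else 0.
have nc0 : 0 <= normc c by exact: normc_ge0.
pose K := \sum_k \sum_(0 <= j < L) (wprod (w (lam k)) j)^-1.
have Kk0 k : 0 <= \sum_(0 <= j < L) (wprod (w (lam k)) j)^-1.
  by rewrite sumr_ge0// => j _; rewrite invr_ge0 ltW.
have K0 : 0 <= K by exact: sumr_ge0.
have KK k : \sum_(0 <= j < L) (wprod (w (lam k)) j)^-1 <= K.
  by rewrite /K (bigD1 k)//= lerDl sumr_ge0.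
(* [eta] and [eps] keep the error from [z - y] and that from [approximates] at most [er / 4] each;
   with the tail of [v] the total stays below [er]. *)
pose eta := er / 4 / (1 + normc c * K).
have cK : 0 < 1 + normc c * K by rewrite ltr_pwDl// mulr_ge0.
have eta0 : 0 < eta by rewrite divr_gt0.
pose eps := er / 4 / (1 + normc c + B).
have cB : 0 < 1 + normc c + B by rewrite ltr_wpDr// ltr_pwDl.
have eps0 : 0 < eps by rewrite divr_gt0.
have [|y [yL zy [n n1 un]]] := Happ m.+1 L z eta eps isT eta0 eps0.
  by move=> k j Lj; rewrite /z ltnNge (leq_trans (LkL k) Lj).
exists (iter n (wshift_prod w lam) x); split; last by exists n.
apply: eO => k; set D := v k - _.
rewrite -[`|D|]/((seqnorm X D)%:C) ltcR.
have TE j : iter n (wshift_prod w lam) x k j =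
    (wprod (w (lam k)) j)^-1%:C * ((wprod (w (lam k)) (j + n)%N)%:C * x k (j + n)%N).
  rewrite -(@iter_wshift_prodE R X d w lam x n k j (wX k)).
  by rewrite mulrA -rmorphM mulVf ?gt_eqF// mul1r.
pose g : nat -> R[i] := fun j => D j - seqtail (Lk k) (v k) j.
have DE : seqval D = seqtail (Lk k) (v k) + g by apply/funext => j; rewrite /g addrC subrK.
(* Three errors: from [z] to [y], from [y] to the power of [u], and the higher-order terms. *)
have gE j : g j = (wprod (w (lam k)) j)^-1%:C * c * (z k j - y k j)
    - c * ((wprod (w (lam k)) j)^-1%:C *
       ((wprod (w (lam k)) (j + n)%N)%:C * u k (j + n)%N ^+ m.+1 - y k j))
    - (wprod (w (lam k)) j)^-1%:C * (wprod (w (lam k)) (j + n)%N)%:C *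
       u k (j + n)%N ^+ m.+1 * (q.[u k (j + n)%N] - c).
  have -> : g j = v k j - iter n (wshift_prod w lam) x k j - seqtail (Lk k) (v k) j by [].
  have Xq : 'X * ('X^m * q) = 'X^(m.+1) * q :> {poly R[i]} by rewrite mulrA -exprS.
  rewrite TE xE pE Xq hornerM hornerXn /seqtail /z.
  case: ifP => _; last by ring.
  rewrite fmorphV; field.
  by rewrite q0 fmorph_eq0 gt_eqF.
have gle j : normc (g j) <= normc c * eta * (if (j < L)%N then (wprod (w (lam k)) j)^-1 else 0)
    + normc c * normc ((wprod (w (lam k)) j)^-1%:C *
       ((wprod (w (lam k)) (j + n)%N)%:C * u k (j + n)%N ^+ m.+1 - y k j))
    + B * ((wprod (w (lam k)) j)^-1 * wprod (w (lam k)) (j + n)%N *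
       normc (u k (j + n)%N) ^+ m.+2).
  have iP0 : 0 <= (wprod (w (lam k)) j)^-1 by rewrite invr_ge0 ltW.
  rewrite gE; apply: le_trans (normcB_le _ _) _; apply: lerD.
    apply: le_trans (normcB_le _ _) _; apply: lerD; last by rewrite normcM.
    rewrite !normcM normc_real ger0_norm//.
    case: ltnP => [_|Lj]; last first.
      by rewrite yL// /z ltnNge (leq_trans (LkL k) Lj) subr0 normc0 !mulr0.
    by rewrite -mulrA mulrC ler_wpM2r// ler_wpM2l.
  rewrite !normcM !normc_real !ger0_norm ?(ltW (P0 _ _))// normcX.
  rewrite [leRHS](_ : _ = (wprod (w (lam k)) j)^-1 * wprod (w (lam k)) (j + n)%N *
    normc (u k (j + n)%N) ^+ m.+1 * (B * normc (u k (j + n)%N))); last by rewrite [in LHS]exprSr; ring.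
  rewrite ler_wpM2l ?qB// mulr_ge0 ?exprn_ge0 ?normc_ge0// mulr_ge0// ltW//.
have gM M : \sum_(0 <= j < M) normc (g j) <= er / 2.
  have [un1 un2] := un k M.
  apply: le_trans (ler_sum _ (fun j _ => gle j)) _.
  rewrite !big_split/= -!mulr_sumr.
  have s1 : \sum_(0 <= j < M) (if (j < L)%N then (wprod (w (lam k)) j)^-1 else 0) <= K.
    apply: le_trans (@sum_le_support _ _ L M _ _) _.
    - by move=> j; case: ifP => // _; rewrite invr_ge0 ltW.
    - by move=> j; rewrite ltnNge => ->.
    apply: le_trans (KK k); apply: ler_sum_nat => j /andP[_ ->]; exact: lexx.
  have t1 : normc c * eta * \sum_(0 <= j < M)
      (if (j < L)%N then (wprod (w (lam k)) j)^-1 else 0) <= er / 4.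
    apply: (@le_trans _ _ (normc c * eta * K)).
      by rewrite ler_wpM2l// mulr_ge0// ltW.
    rewrite mulrAC mulrC /eta mulrAC ler_pdivrMr//.
    by rewrite ler_wpM2l ?(ltW er4)// lerDr.
  have t2 : (normc c + B) * eps <= er / 4.
    rewrite mulrC /eps mulrAC ler_pdivrMr//.
    by rewrite ler_wpM2l ?(ltW er4)// -addrA lerDr.
  have t3 := ler_wpM2l nc0 un1; have t4 := ler_wpM2l B0 un2.
  move: t1 t2 t3 t4; rewrite mulrDl.
  set a1 := _ * \sum_(0 <= j < M) _; set a2 := _ * \sum_(0 <= j < M) _.
  set a3 := _ * \sum_(0 <= j < M) _.
  by clearbody a1 a2 a3; clear; lra.
have [gX gn] := l1_in_seqspace X gM.
have [tX tn] := LkP k.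
rewrite DE; have [_ le] := seqnormD tX gX.
by apply: le_lt_trans le _; move: tn gn er0; clear; lra.
Qed.

(** * A countable family of tasks *)

Lemma ln_wprod (R : realType) (w : nat -> R) n : weight w ->
  ln (wprod w n) = \sum_(1 <= i < n.+1) ln (w i).
Proof.
move=> w0; elim: n => [|n IH]; first by rewrite /wprod !big_geq// ln1.
rewrite big_nat_recr//= -IH -lnM ?posrE ?wprod_gt0 ?w0//.
by rewrite /wprod [in LHS]big_nat_recr.
Qed.

Lemma approximates_le (R : realType) (J : Type) (W : J -> nat -> R) m0
    (y u : J -> nat -> R[i]) (e1 e2 : R) :
  e1 <= e2 -> approximates W m0 y e1 u -> approximates W m0 y e2 u.
Proof.
move=> e12 [n n1 un]; exists n => // k M.
by have [h1 h2] := un k M; split; [exact: le_trans h1 e12|exact: le_trans h2 e12].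
Qed.

(** Serves tasks with an empty parameter set, where only the length has to grow; the added
    coordinate is 0. *)
Lemma cylinder_shrink (R : realType) (J : Type) (f : J -> nat -> R[i]) n (e : R) :
  exists f', cylinder f' n.+1 e `<=` cylinder f n e.
Proof.
exists (fun k j => if (j < n)%N then f k j else 0) => u [u1 u2].
split=> [k j jn|k M]; first by rewrite u1 ?jn// ltnW.
have [Mn|nM] := leqP M n.
  by apply: le_trans (u2 k M); rewrite !big_geq// ltnW.
rewrite big_ltn// u1// ltnn; have -> : normc (0 : R[i]) = 0 by exact: normc0.
by rewrite add0r.
Qed.

Definition ratc (R : realType) (z : rat * rat) : R[i] := (ratr z.1 +i* ratr z.2)%C.

Lemma ratc_dense (R : realType) (z : R[i]) (e : R) : 0 < e ->
  exists q, normc (z - ratc R q) <= e.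
Proof.
move=> e0; case: z => a b.
have half (t : R) : exists q : rat, `|t - ratr q| <= e / 2.
  have [|q] := @rat_in_itvoo R (t - e / 2) (t + e / 2).
    by move: e0; clear; lra.
  rewrite in_itv/= => qt; exists q; rewrite ler_norml.
  by move: qt; clear; lra.
have [[q1 h1] [q2 h2]] := (half a, half b); exists (q1, q2).
have -> : (a +i* b)%C - ratc R (q1, q2) = (a - ratr q1)%:C + 'i%C * (b - ratr q2)%:C.
  by rewrite /ratc; simpc.
apply: le_trans (le_normcD _ _) _; rewrite normcM !normc_real.
have -> : normc ('i%C : R[i]) = 1.
  by rewrite /normc expr0n/= add0r expr1n sqrtr1.
by rewrite mul1r (splitr e) lerD.
Qed.

(** Nested lists make the targets a countable type independent of [d]; missing entries read as
    [(0, 0)], so every target has finite support. *)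
Definition ratc_seqs (R : realType) (s : seq (seq (rat * rat))) (k j : nat) : R[i] :=
  ratc R (nth (0, 0) (nth [::] s k) j).

Lemma ratc0 (R : realType) : ratc R (0, 0) = 0.
Proof. by rewrite /ratc /= rmorph0. Qed.

Lemma ratc_seqs_dense (R : realType) (d L : nat) (z : 'I_d -> nat -> R[i]) (e : R) :
  0 < e -> (forall k j, (L <= j)%N -> z k j = 0) ->
  exists s, (forall (k : 'I_d) j, (L <= j)%N -> ratc_seqs R s k j = 0) /\
            (forall (k : 'I_d) j, normc (z k j - ratc_seqs R s k j) <= e).
Proof.
move=> e0 zL.
have /choice[q qP] (kj : 'I_d * nat) := ratc_dense (z kj.1 kj.2) e0.
pose s := [seq mkseq (fun j => q (k, j)) L | k <- enum 'I_d].
have sE (k : 'I_d) : nth [::] s k = mkseq (fun j => q (k, j)) L.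
  by rewrite (nth_map k) ?size_enum_ord// nth_ord_enum.
have sL (k : 'I_d) j : (L <= j)%N -> ratc_seqs R s k j = 0.
  by move=> Lj; rewrite /ratc_seqs sE nth_default ?size_mkseq// ratc0.
exists s; split=> // k j; have [jL|Lj] := ltnP j L.
  by rewrite /ratc_seqs sE nth_mkseq//; exact: (qP (k, j)).
by rewrite sL// zL// subr0 normc0 ltW.
Qed.

Lemma ratc_seqs_support (R : realType) (d : nat) (s : seq (seq (rat * rat))) :
  exists L, forall (k : 'I_d) j, (L <= j)%N -> ratc_seqs R s k j = 0.
Proof.
exists (\max_(k < d) size (nth [::] s k))%N => k j Lj.
rewrite /ratc_seqs nth_default ?ratc0//; apply: leq_trans Lj.
exact: (leq_bigmax k).
Qed.

Lemma nat_upper_bound (R : realType) (d : nat) (x : 'I_d -> R) :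
  exists n : nat, forall k, x k <= n%:R.
Proof.
exists (\max_k Num.bound `|x k|)%N => k.
apply: le_trans (ler_norm _) _; apply: le_trans (ltW (archi_boundP (normr_ge0 _))) _.
by rewrite ler_nat; exact: (leq_bigmax k).
Qed.

(** * Construction of the algebra *)

Theorem corollary1p2 (R : realType) (d : nat) (X : seqspace R) (I : set R)
    (w : R -> nat -> R)
    (d_ge1 : (1 <= d)%N)
    (I_pos : I `<=` [set a | 0 < a])
    (I_sigma_compact : sigma_compact I)
    (w_weight : forall a, I a -> weight (w a))
    (w_admissible : forall a, I a -> admissible X (w a))
    (w_continuous : continuous_family X d I w)
    (w_growth : forall I0 : set R, compact I0 -> I0 `<=` I ->
      exists (D1 D2 gamma : R) (N : nat),
        [/\ 0 < D1, 0 < D2, 0 < gamma &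
          forall n, (N <= n)%N ->
            (D1 * ln n%:R).-lipschitz_I0
               (fun a : R => \sum_(1 <= i < n.+1) ln (w a i) : R) /\
            ((D2 * n%:R `^ gamma)%:E <=
              ereal_inf [set (\prod_(1 <= i < n.+1) w a i)%:E | a in I0])%E]) :
  common_hypercyclic_algebra (@power_mul R X d) (cube d I)
    (@wshift_prod R X d w).
Proof.
have [K [Kc IE]] := I_sigma_compact.
(* Increasing unions, so that the [d] coordinates of a parameter lie in a common compact set. *)
pose K' i := \big[setU/set0]_(j < i.+1) K j.
have K'E i a : K' i a <-> exists2 j, (j < i.+1)%N & K j a.
  by rewrite /K' -bigcup_mkord.
have K'I i : K' i `<=` I by move=> a /K'E[j _ Kja]; rewrite IE; exists j.
have K'c i : compact (K' i) by apply: bigsetU_compact => j _; exact: Kc.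
have /choice[par parP] i : exists p : R * R * R * R * nat,
    let: (D1, D2, gamma, rho, N0) := p in
    [/\ [/\ 0 < D1, 0 < D2, 0 < gamma, 0 < rho & D1 * rho <= gamma / 2],
     forall a b N, K' i a -> K' i b -> (N0 <= N)%N ->
       `|ln (wprod (w a) N) - ln (wprod (w b) N)| <= D1 * ln N%:R * `|a - b| &
     forall a N, K' i a -> (N0 <= N)%N -> D2 * N%:R `^ gamma <= wprod (w a) N].
  have [D1 [D2 [gamma [N0 [D10 D20 g0 H]]]]] := w_growth (K' i) (K'c i) (@K'I i).
  exists (D1, D2, gamma, gamma / 2 / D1, N0); split.
  - by split; rewrite ?divr_gt0// mulrC divfK// gt_eqF.
  - move=> a b N Ka Kb N0N; have [lip _] := H N N0N.
    rewrite !ln_wprod; try by apply: w_weight; apply: K'I; eassumption.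
    exact: (lip (a, b) (conj Ka Kb)).
  - move=> a N Ka N0N; have [_ inf] := H N N0N; rewrite -lee_fin.
    by apply: le_trans inf _; apply: ereal_inf_lbound; exists a.
pose rho i := (par i).1.2.
(* In order: compact set, weight bound, position of the cube, degree, target, precision. *)
pose task := (nat * nat * seq nat * nat * seq (seq (rat * rat)) * nat)%type.
pose Q (i C : nat) (c : seq nat) (k : 'I_d) : set R :=
  [set a | [/\ K' i a, (nth 0%N c k)%:R * rho i <= a <= (nth 0%N c k)%:R * rho i + rho i &
               forall j, (1 <= j)%N -> w a j <= C.+1%:R]].
pose meets (t : task) : set ('I_d -> nat -> R[i]) :=
  let: (i, C, c, m0, y, r) := t in
  [set u | forall lam : 'I_d -> R, (forall k, Q i C c k (lam k)) ->
    approximates (fun k => w (lam k)) m0.+1 (fun k => ratc_seqs R y k) r.+1%:R^-1 u].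
pose t0 : task := (0%N, 0%N, [::], 0%N, [::], 0%N).
(* Coordinate 0 equals 1, which makes [u] nonzero; the remaining [l^1] mass will be at most 1, so
   all moduli are at most 1. *)
pose f0 (k : 'I_d) (j : nat) : R[i] := if (j < 1)%N then 1 else 0.
(* Integers that code no task are given the dummy [t0]. *)
have step n0 f n (e : R) : 0 < e -> exists f' n' e',
    [/\ 0 < e', (n < n')%N, cylinder f' n' e' `<=` cylinder f n e &
        cylinder f' n' e' `<=` meets (odflt t0 (unpickle n0))].
  case: (odflt _ _) => -[[[[i C] c] m0] y] r e0.
  (* The net needs a base point; without one the task holds vacuously. *)
  have [[a0 Qa0]|no] := pselect (exists a0 : 'I_d -> R, forall k, Q i C c k (a0 k)); last first.
    have [f' f'P] := cylinder_shrink f n e; exists f', n.+1, e; split=> // u _ lam Qlam.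
    by exfalso; apply: no; exists lam.
  have := parP i; case E: (par i) => [[[[D1 D2] gamma] rh] N0].
  have <- : rho i = rh by rewrite /rho E.
  move=> [[D10 D20 g0 rh0 D1rh] lip low].
  have [L yL] := ratc_seqs_support R d y.
  apply: (@approximation_step R d w _ a0 (fun k => (nth 0%N c k)%:R * rho i) (rho i) C.+1%:R D1 D2
    gamma N0 L m0.+1 (fun k => ratc_seqs R y k) r.+1%:R^-1 f n e) => //.
  - by rewrite ler1n.
  - by move=> k a [].
  - by move=> k a [/K'I/w_weight].
  - by move=> k a [].
  - by move=> k a b N [Ka _ _] [Kb _ _]; exact: lip.
  - by move=> k a N [Ka _ _]; exact: low.
have [u0 [u01 u02] u0P] := cylinder_fusion step f0 1%N (@ltr01 R).
have u0E k : u0 k 0%N = 1 by rewrite u01.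
have u0_le1 k j : normc (u0 k j) <= 1.
  case: j => [|j]; first by rewrite u0E normc1.
  apply: le_trans (u02 k j.+2); rewrite big_nat_recr//= lerDr sumr_ge0// => ? _.
  exact: normc_ge0.
have u0X k : u0 k \in in_seqspace X.
  have [|//] := @l1_in_seqspace R X (u0 k) (1 + 1).
  case=> [|M]; first by rewrite big_geq.
  rewrite big_ltn//; apply: lerD; [exact: u0_le1|exact: u02].
pose u : power d X := fun k => Seqs (u0X k).
exists [set x : power d X | exists p : {poly R[i]}, forall k j, x k j = ('X * p).[u k j]].
split.
- split.
  + by exists 0 => k j; rewrite mulr0 horner0.
  + move=> x y [p xp] [q yq]; exists (p + q) => k j.
    by rewrite mulrDr hornerD -xp -yq.
  + move=> c x [p xp]; exists (c *: p) => k j.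
    by rewrite -scalerAr hornerZ -xp.
  + move=> x y [p xp] [q yq]; exists (p * ('X * q)) => k j.
    by rewrite mulrA hornerM -xp -yq.
- exists u; split; first by exists 1 => k j; rewrite mulr1 hornerX.
  move=> u_eq0; have := u0E (Ordinal d_ge1).
  rewrite -[LHS]/(u (Ordinal d_ge1) 0%N) u_eq0 => /esym/eqP.
  by rewrite oner_eq0.
move=> x [[p xp] x0] lam Ilam.
apply: (@approximates_HC R X d w lam u x p).
- by move=> k; exact/w_weight/Ilam.
- by move=> k; exact/w_admissible/Ilam.
- exact: u0_le1.
- apply/eqP => p_eq0; apply: x0; apply/funext => k; apply/val_inj/funext => j.
  by rewrite -[LHS]/(x k j) xp p_eq0 mulr0 horner0.
- exact: xp.
move=> [//|m0] L z eta eps _ eta0 eps0 zL.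
have [y [yL zy]] := ratc_seqs_dense eta0 zL.
exists (fun k => ratc_seqs R y k); split=> //.
(* It remains to find a task whose parameter set contains [lam] and whose precision is at most
   [eps]. *)
have [r rP] := nat_upper_bound (fun _ : 'I_1 => eps^-1).
have /choice[ik ikP] k : exists i, K i (lam k).
  by have := Ilam k; rewrite IE => -[i _ Ki]; exists i.
pose i := (\max_k ik k)%N.
have lamK' k : K' i (lam k).
  by apply/K'E; exists (ik k); rewrite ?ltnS//; exact: leq_bigmax.
have /choice[Ck CkP] k := admissible_bounded (w_weight _ (Ilam k)) (w_admissible _ (Ilam k)).
have [C CP] := nat_upper_bound Ck.
have rho0 : 0 < rho i.
  by have := parP i; rewrite /rho; case: (par i) => [[[[D1 D2] gamma] rh] N0] /= [[]].
have /choice[ck ckP] k : exists c : nat, c%:R * rho i <= lam k <= c%:R * rho i + rho i.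
  (* Positivity of [lam k] gives its cell a natural number as index. *)
  have lam0 : 0 < lam k by exact: I_pos (Ilam k).
  have q0 : 0 <= lam k / rho i by rewrite divr_ge0 ?ltW.
  have [||t _ /andP[t1 t2]] := @unit_cell R (Num.bound (lam k / rho i)) (lam k / rho i).
  - by rewrite -(ltr_nat R); apply: le_lt_trans (archi_boundP q0).
  - by rewrite q0 ltW// archi_boundP.
  exists t; rewrite ler_pdivlMr// in t1; rewrite ler_pdivrMr// in t2.
  by rewrite t1 (le_trans t2)// -natr1 mulrDl mul1r.
pose c := [seq ck k | k <- enum 'I_d].
have cE (k : 'I_d) : nth 0%N c k = ck k by rewrite (nth_map k) ?size_enum_ord// nth_ord_enum.
pose t : task := (i, C, c, m0, y, r).
have := u0P (pickle t); rewrite pickleK /= => /(_ lam) ut.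
apply: approximates_le (ut _).
  rewrite -[leRHS]invrK lef_pV2 ?posrE ?invr_gt0// (le_trans (rP ord0))//.
  by rewrite ler_nat.
move=> k; split; [exact: lamK'|by rewrite cE; exact: ckP|] => j j1.
apply: le_trans (CkP k j j1) _; apply: le_trans (CP k) _.
by rewrite ler_nat.
Qed.
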